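(* Let $0<q<1$ and let $\alpha>0$ be real. Let $a(l,m;l',m';l'',m'')$ be the linearization coefficients of the $q$-disk polynomials, i.e. the unique coefficients (for fixed $l,m,l',m'$ only finitely many non-zero) such that in the algebra $\mathcal{Z}$ $$R_{l,m}^{(\alpha)}(z,z^{*};q^2)\, R_{l',m'}^{(\alpha)}(z,z^{*};q^2)^{*}=\sum_{l'',m''\in\mathbb{Z}_+} a(l,m;l',m';l'',m'')\,R_{l'',m''}^{(\alpha)}(z,z^{*};q^2).$$ Then for all $(l,m),(l',m'),(l'',m'')\in\mathbb{Z}_+^2$ one has $$a(l,m;l',m';l'',m'')\ge 0 .$$
   Context: $\mathbb{Z}_+=\{0,1,2,\dots\}$ and $0<q<1$ is fixed. For $k\in\mathbb{Z}_+$, $(a;q)_k=\prod_{j=0}^{k-1}(1-aq^j)$. $\mathcal{Z}$ is the complex unital $*$-algebra generated by elements $z$ and $z^{*}$ (with $(z)^{*}=z^{*}$) subject to the single relation $z^{*}z=q^2zz^{*}+1-q^2$; the set $\{z^k(z^{*})^l : k,l\in\mathbb{Z}_+\}$ is a linear basis of $\mathcal{Z}$. Little $q$-Jacobi polynomials in base $q^2$: for $m\in\mathbb{Z}_+$ and real $\alpha,\beta>-1$, $$P_m^{(\alpha,\beta)}(x;q^2)=\sum_{k=0}^m\frac{(q^{-2m};q^2)_k\,(q^{2(\alpha+\beta+m+1)};q^2)_k}{(q^{2(\alpha+1)};q^2)_k\,(q^2;q^2)_k}\,(q^2x)^k .$$ $q$-disk polynomials: for real $\alpha>-1$ and $l,m\in\mathbb{Z}_+$,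 the element $R_{l,m}^{(\alpha)}(z,z^{*};q^2)\in\mathcal{Z}$ is $$R_{l,m}^{(\alpha)}(z,z^{*};q^2)=\begin{cases} z^{l-m}\,P_m^{(\alpha,l-m)}(1-zz^{*};q^2), & l\ge m,\\ P_l^{(\alpha,m-l)}(1-zz^{*};q^2)\,(z^{*})^{m-l}, & l\le m.\end{cases}$$ The elements $R_{l,m}^{(\alpha)}(z,z^{*};q^2)$, $l,m\in\mathbb{Z}_+$, form a linear basis of $\mathcal{Z}$. *)

(* Defs.v *)
From HB Require Import structures.
From mathcomp Require Import all_boot all_order all_algebra.
From mathcomp Require Import generic_quotient complex.
From mathcomp Require Import all_classical all_reals exp.

Set Implicit Arguments.
Unset Strict Implicit.
Unset Printing Implicit Defensive.

Import Order.TTheory GRing.Theory Num.Theory.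
Local Open Scope ring_scope.
Local Open Scope complex_scope.
Local Open Scope quotient_scope.

(* The *-algebra of the quantum disk is given by its presentation: formal
   expressions in one generator z, modulo the least congruence that contains
   the axioms of complex unital *-algebras and z^* z = q^2 z z^* + 1 - q^2. *)
Inductive qd_term (R : Type) : Type :=
  | QDgen
  | QDzero
  | QDone
  | QDopp of qd_term R
  | QDadd of qd_term R & qd_term R
  | QDmul of qd_term R & qd_term R
  | QDscale of R[i] & qd_term R
  | QDstar of qd_term R.

Arguments QDgen {R}.
Arguments QDzero {R}.
Arguments QDone {R}.

HB.instance Definition _ (R : Type) := gen_eqMixin (qd_term R).
HB.instance Definition _ (R : Type) := gen_choiceMixin (qd_term R).

Inductive qd_cong (R : realType) (q : R) : qd_term R -> qd_term R -> Prop :=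
  | QDC_refl x : qd_cong q x x
  | QDC_sym x y : qd_cong q x y -> qd_cong q y x
  | QDC_trans x y t : qd_cong q x y -> qd_cong q y t -> qd_cong q x t
  | QDC_opp x x' : qd_cong q x x' -> qd_cong q (QDopp x) (QDopp x')
  | QDC_add x x' y y' : qd_cong q x x' -> qd_cong q y y' ->
      qd_cong q (QDadd x y) (QDadd x' y')
  | QDC_mul x x' y y' : qd_cong q x x' -> qd_cong q y y' ->
      qd_cong q (QDmul x y) (QDmul x' y')
  | QDC_scale c x x' : qd_cong q x x' ->
      qd_cong q (QDscale c x) (QDscale c x')
  | QDC_star x x' : qd_cong q x x' -> qd_cong q (QDstar x) (QDstar x')
  | QDC_addA x y t :
      qd_cong q (QDadd x (QDadd y t)) (QDadd (QDadd x y) t)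
  | QDC_addC x y : qd_cong q (QDadd x y) (QDadd y x)
  | QDC_add0 x : qd_cong q (QDadd QDzero x) x
  | QDC_addN x : qd_cong q (QDadd (QDopp x) x) QDzero
  | QDC_mulA x y t :
      qd_cong q (QDmul x (QDmul y t)) (QDmul (QDmul x y) t)
  | QDC_mul1l x : qd_cong q (QDmul QDone x) x
  | QDC_mul1r x : qd_cong q (QDmul x QDone) x
  | QDC_mulDl x y t :
      qd_cong q (QDmul (QDadd x y) t) (QDadd (QDmul x t) (QDmul y t))
  | QDC_mulDr x y t :
      qd_cong q (QDmul x (QDadd y t)) (QDadd (QDmul x y) (QDmul x t))
  | QDC_scaleA c d x :
      qd_cong q (QDscale c (QDscale d x)) (QDscale (c * d) x)
  | QDC_scale1 x : qd_cong q (QDscale 1 x) x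
  | QDC_scaleDr c x y :
      qd_cong q (QDscale c (QDadd x y)) (QDadd (QDscale c x) (QDscale c y))
  | QDC_scaleDl c d x :
      qd_cong q (QDscale (c + d) x) (QDadd (QDscale c x) (QDscale d x))
  | QDC_scaleAl c x y :
      qd_cong q (QDscale c (QDmul x y)) (QDmul (QDscale c x) y)
  | QDC_scaleAr c x y :
      qd_cong q (QDscale c (QDmul x y)) (QDmul x (QDscale c y))
  | QDC_starK x : qd_cong q (QDstar (QDstar x)) x
  | QDC_starD x y :
      qd_cong q (QDstar (QDadd x y)) (QDadd (QDstar x) (QDstar y))
  | QDC_starM x y :
      qd_cong q (QDstar (QDmul x y)) (QDmul (QDstar y) (QDstar x))
  | QDC_starZ c x :
      qd_cong q (QDstar (QDscale c x)) (QDscale (conjc c) (QDstar x))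
  | QDC_rel :
      qd_cong q (QDmul (QDstar QDgen) QDgen)
        (QDadd (QDscale (q ^+ 2)%:C (QDmul QDgen (QDstar QDgen)))
               (QDscale (1 - q ^+ 2)%:C QDone)).

Section QuantumDisk.
Variables (R : realType) (q : R).

Definition qd_eqv (x y : qd_term R) : bool := `[< qd_cong q x y >].

Lemma qd_eqv_refl : reflexive qd_eqv.
Proof. by move=> x; apply/asboolP; exact: QDC_refl. Qed.

Lemma qd_eqv_sym : symmetric qd_eqv.
Proof. by move=> x y; apply/asboolP/asboolP; exact: QDC_sym. Qed.

Lemma qd_eqv_trans : transitive qd_eqv.
Proof.
by move=> y x t /asboolP xy /asboolP yt; apply/asboolP; exact: QDC_trans xy yt.
Qed.

Canonical qd_eqv_equiv := EquivRel qd_eqv qd_eqv_refl qd_eqv_sym qd_eqv_trans.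

Definition qdisk : Type := {eq_quot qd_eqv}.
HB.instance Definition _ := Choice.on qdisk.
HB.instance Definition _ := EqQuotient.on qdisk.

Lemma qd_piP (x y : qd_term R) : qd_cong q x y <-> \pi_qdisk x = \pi_qdisk y.
Proof.
split=> [xy|]; first by apply/eqmodP/asboolP.
by move=> /eqmodP/asboolP.
Qed.

Lemma qd_repr (x : qd_term R) : qd_cong q (repr (\pi_qdisk x)) x.
Proof. by apply/qd_piP; rewrite reprK. Qed.

Definition qd_zero : qdisk := \pi_qdisk QDzero.
Definition qd_one : qdisk := \pi_qdisk QDone.
Definition qd_opp := lift_op1 qdisk (@QDopp R).
Definition qd_add := lift_op2 qdisk (@QDadd R).
Definition qd_mul := lift_op2 qdisk (@QDmul R).
Definition qd_scale (c : R[i]) := lift_op1 qdisk (QDscale c).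
Definition qd_star := lift_op1 qdisk (@QDstar R).
Definition qd_z : qdisk := \pi_qdisk QDgen.

Lemma pi_opp x : qd_opp (\pi_qdisk x) = \pi_qdisk (QDopp x).
Proof. by unlock qd_opp; apply/qd_piP; apply: QDC_opp; exact: qd_repr. Qed.

Lemma pi_add x y : qd_add (\pi_qdisk x) (\pi_qdisk y) = \pi_qdisk (QDadd x y).
Proof. by unlock qd_add; apply/qd_piP; apply: QDC_add; exact: qd_repr. Qed.

Lemma pi_mul x y : qd_mul (\pi_qdisk x) (\pi_qdisk y) = \pi_qdisk (QDmul x y).
Proof. by unlock qd_mul; apply/qd_piP; apply: QDC_mul; exact: qd_repr. Qed.

Lemma pi_scale c x : qd_scale c (\pi_qdisk x) = \pi_qdisk (QDscale c x).
Proof. by unlock qd_scale; apply/qd_piP; apply: QDC_scale; exact: qd_repr. Qed.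

Lemma pi_star x : qd_star (\pi_qdisk x) = \pi_qdisk (QDstar x).
Proof. by unlock qd_star; apply/qd_piP; apply: QDC_star; exact: qd_repr. Qed.

Let piE := (pi_opp, pi_add, pi_mul, pi_scale, pi_star).

Lemma qd_addA : associative qd_add.
Proof.
elim/quotW=> x; elim/quotW=> y; elim/quotW=> t; rewrite !piE.
by apply/qd_piP; exact: QDC_addA.
Qed.

Lemma qd_addC : commutative qd_add.
Proof.
by elim/quotW=> x; elim/quotW=> y; rewrite !piE; apply/qd_piP; exact: QDC_addC.
Qed.

Lemma qd_add0 : left_id qd_zero qd_add.
Proof. by elim/quotW=> x; rewrite !piE; apply/qd_piP; exact: QDC_add0. Qed.

Lemma qd_addN : left_inverse qd_zero qd_opp qd_add.
Proof. by elim/quotW=> x; rewrite !piE; apply/qd_piP; exact: QDC_addN. Qed.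

HB.instance Definition _ :=
  GRing.isZmodule.Build qdisk qd_addA qd_addC qd_add0 qd_addN.

Lemma qd_addE : +%R = qd_add. Proof. by []. Qed.

Lemma qd_mulA : associative qd_mul.
Proof.
elim/quotW=> x; elim/quotW=> y; elim/quotW=> t; rewrite !piE.
by apply/qd_piP; exact: QDC_mulA.
Qed.

Lemma qd_mul1l : left_id qd_one qd_mul.
Proof. by elim/quotW=> x; rewrite !piE; apply/qd_piP; exact: QDC_mul1l. Qed.

Lemma qd_mul1r : right_id qd_one qd_mul.
Proof. by elim/quotW=> x; rewrite !piE; apply/qd_piP; exact: QDC_mul1r. Qed.

Lemma qd_mulDl : left_distributive qd_mul +%R.
Proof.
elim/quotW=> x; elim/quotW=> y; elim/quotW=> t; rewrite !(qd_addE, piE).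
by apply/qd_piP; exact: QDC_mulDl.
Qed.

Lemma qd_mulDr : right_distributive qd_mul +%R.
Proof.
elim/quotW=> x; elim/quotW=> y; elim/quotW=> t; rewrite !(qd_addE, piE).
by apply/qd_piP; exact: QDC_mulDr.
Qed.

(* The *-character z |-> 1, used only to see that 1 != 0. *)
Fixpoint qd_char (x : qd_term R) : R[i] :=
  match x with
  | QDgen => 1
  | QDzero => 0
  | QDone => 1
  | QDopp x => - qd_char x
  | QDadd x y => qd_char x + qd_char y
  | QDmul x y => qd_char x * qd_char y
  | QDscale c x => c * qd_char x
  | QDstar x => conjc (qd_char x)
  end.

Lemma qd_charP x y : qd_cong q x y -> qd_char x = qd_char y.
Proof.
elim=> //=.
- by move=> ? ? ? _ -> _ ->.
- by move=> ? ? _ ->.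
- by move=> ? ? ? ? _ -> _ ->.
- by move=> ? ? ? ? _ -> _ ->.
- by move=> ? ? ? _ ->.
- by move=> ? ? _ ->.
- by move=> ? ? ?; rewrite addrA.
- by move=> ? ?; rewrite addrC.
- by move=> ?; rewrite add0r.
- by move=> ?; rewrite addNr.
- by move=> ? ? ?; rewrite mulrA.
- by move=> ?; rewrite mul1r.
- by move=> ?; rewrite mulr1.
- by move=> ? ? ?; rewrite mulrDl.
- by move=> ? ? ?; rewrite mulrDr.
- by move=> ? ? ?; rewrite mulrA.
- by move=> ?; rewrite mul1r.
- by move=> ? ? ?; rewrite mulrDr.
- by move=> ? ? ?; rewrite mulrDl.
- by move=> ? ? ?; rewrite mulrA.
- by move=> ? ? ?; rewrite mulrCA.
- by move=> ?; rewrite conjcK.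
- by move=> ? ?; rewrite rmorphD.
- by move=> ? ?; rewrite rmorphM mulrC.
- by move=> ? ?; rewrite rmorphM.
- by rewrite oppr0 !mulr1 -rmorphD addrC subrK.
Qed.

Lemma qd_one_neq0 : qd_one != 0.
Proof.
apply/eqP => /qd_piP /qd_charP /= /eqP.
by rewrite oner_eq0.
Qed.

HB.instance Definition _ := GRing.Zmodule_isNzRing.Build qdisk
  qd_mulA qd_mul1l qd_mul1r qd_mulDl qd_mulDr qd_one_neq0.

Lemma qd_mulE : *%R = qd_mul. Proof. by []. Qed.

Lemma qd_scaleA c d x : qd_scale c (qd_scale d x) = qd_scale (c * d) x.
Proof.
by elim/quotW: x => x; rewrite !piE; apply/qd_piP; exact: QDC_scaleA.
Qed.

Lemma qd_scale1 : left_id 1 qd_scale.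
Proof. by elim/quotW=> x; rewrite !piE; apply/qd_piP; exact: QDC_scale1. Qed.

Lemma qd_scaleDr : right_distributive qd_scale +%R.
Proof.
move=> c; elim/quotW=> x; elim/quotW=> y; rewrite !(qd_addE, piE).
by apply/qd_piP; exact: QDC_scaleDr.
Qed.

Lemma qd_scaleDl x : {morph qd_scale^~ x : c d / c + d}.
Proof.
move=> c d; elim/quotW: x => x; rewrite !(qd_addE, piE).
by apply/qd_piP; exact: QDC_scaleDl.
Qed.

HB.instance Definition _ := GRing.Zmodule_isLmodule.Build R[i] qdisk
  qd_scaleA qd_scale1 qd_scaleDr qd_scaleDl.

Lemma qd_scaleE (c : R[i]) : *:%R c = qd_scale c. Proof. by []. Qed.

Let opE := (qd_addE, qd_mulE, qd_scaleE).

Lemma qd_scaleAl (c : R[i]) (x y : qdisk) : c *: (x * y) = (c *: x) * y.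
Proof.
elim/quotW: x => x; elim/quotW: y => y.
rewrite !(opE, piE).
by apply/qd_piP; exact: QDC_scaleAl.
Qed.

HB.instance Definition _ :=
  GRing.Lmodule_isLalgebra.Build R[i] qdisk qd_scaleAl.

Lemma qd_scaleAr (c : R[i]) (x y : qdisk) : c *: (x * y) = x * (c *: y).
Proof.
elim/quotW: x => x; elim/quotW: y => y.
rewrite !(opE, piE).
by apply/qd_piP; exact: QDC_scaleAr.
Qed.

HB.instance Definition _ :=
  GRing.Lalgebra_isAlgebra.Build R[i] qdisk qd_scaleAr.

Lemma qd_starK : involutive qd_star.
Proof. by elim/quotW=> x; rewrite !piE; apply/qd_piP; exact: QDC_starK. Qed.

Lemma qd_starD (x y : qdisk) : qd_star (x + y) = qd_star x + qd_star y.
Proof.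
elim/quotW: x => x; elim/quotW: y => y; rewrite !(opE, piE).
by apply/qd_piP; exact: QDC_starD.
Qed.

Lemma qd_starM (x y : qdisk) : qd_star (x * y) = qd_star y * qd_star x.
Proof.
elim/quotW: x => x; elim/quotW: y => y; rewrite !(opE, piE).
by apply/qd_piP; exact: QDC_starM.
Qed.

Lemma qd_starZ (c : R[i]) (x : qdisk) :
  qd_star (c *: x) = conjc c *: qd_star x.
Proof.
elim/quotW: x => x; rewrite !(opE, piE).
by apply/qd_piP; exact: QDC_starZ.
Qed.

Lemma qd_rel : qd_star qd_z * qd_z =
  (q ^+ 2)%:C *: (qd_z * qd_star qd_z) + (1 - q ^+ 2)%:C%:A.
Proof.
rewrite !(opE, piE).
by apply/qd_piP; exact: QDC_rel.
Qed.

End QuantumDisk.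

Definition qpochhammer (R : realType) (a p : R) (k : nat) : R :=
  \prod_(j < k) (1 - a * p ^+ j).

(* The coefficient of (q^2 x)^k in the little q-Jacobi polynomial
   P_m^(alpha,beta)(x; q^2); the base of the shifted factorials is q^2. *)
Definition little_qjacobi_coef (R : realType) (q : R) (m : nat)
    (alpha beta : R) (k : nat) : R :=
  qpochhammer (q `^ (- (2 * m%:R))) (q ^+ 2) k
  * qpochhammer (q `^ (2 * (alpha + beta + m%:R + 1))) (q ^+ 2) k
  / (qpochhammer (q `^ (2 * (alpha + 1))) (q ^+ 2) k
     * qpochhammer (q ^+ 2) (q ^+ 2) k).

Definition little_qjacobi (R : realType) (q : R) (m : nat) (alpha beta : R)
    (A : algType R[i]) (x : A) : A :=
  \sum_(k < m.+1)
    (little_qjacobi_coef q m alpha beta k)%:C *: ((q ^+ 2)%:C *: x) ^+ k.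

Definition qdisk_poly (R : realType) (q alpha : R) (l m : nat) : qdisk q :=
  let z := qd_z q in
  let zs := qd_star z in
  if (m <= l)%N then
    z ^+ (l - m) * little_qjacobi q m alpha (l - m)%:R (1 - z * zs)
  else
    little_qjacobi q l alpha (m - l)%:R (1 - z * zs) * zs ^+ (m - l).

(* The finitely supported sum is 0 by convention when the support is infinite,
   whence the first conjunct. *)
Definition is_linearization (R : realType) (q alpha : R)
    (a : nat -> nat -> nat -> nat -> nat -> nat -> R[i]) : Prop :=
  forall l m l' m' : nat,
    finite_set [set p : nat * nat | a l m l' m' p.1 p.2 != 0] /\
    qdisk_poly q alpha l m * qd_star (qdisk_poly q alpha l' m') =
    \sum_(p \in [set: nat * nat])
       a l m l' m' p.1 p.2 *: qdisk_poly q alpha p.1 p.2.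

(* Main.v *)
Require Import Defs.
From mathcomp Require Import all_boot all_order all_algebra.
From mathcomp Require Import generic_quotient complex.
From mathcomp Require Import all_classical all_reals exp.
From mathcomp Require Import zify ring.
Set Implicit Arguments.
Unset Strict Implicit.
Unset Printing Implicit Defensive.
Import Order.TTheory GRing.Theory Num.Theory.
Local Open Scope ring_scope.
Local Open Scope complex_scope.
Local Open Scope quotient_scope.

(* Put Q = q^2 and a = Q^alpha.  Let z and z^* act on sequences by
   t^n |-> t^(n+1) and t^n |-> (1 - Q^n) t^(n-1).  Then R_{l,m} maps t^n to
   r_{l,m}(Q^n) t^(n+l-m) with
     r_{l,m}(X) = 2phi1(Q^-m, a Q^(l+1); a Q; Q, Q X),
   for l >= m by definition and for l < m by Euler's transformation, so that
   the product R_{l,m} R_{l',m'} becomes r_{l,m}(Q^(l'-m') X) r_{l',m'}(X).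
   This polynomial is W_{0,0} in the family of products
     W_{k,j}(X) = A_{l-k,m-j}(Q^(l'-j-m'+k) X) X^(k+j) A_{l'-j,m'-k}(X),
   where A_{l,m} is r_{l,m} with a Q^(k+j) in place of a; these are the products
   of the factors that occur in the addition formula.  The little q-Jacobi
   operator D, with D r_n = lambda_n r_n, maps W_{k,j} to a combination of
   itself and its four neighbours, and it is symmetric for weights
   C_{k,j} >= 0, C_{0,0} = 1.  Writing W_{k,j} = sum_n w_n(k,j) r_n, symmetry
   gives sum_{k,j} C_{k,j} w_n(k,j) w_n'(k,j) = 0 for n <> n', because the
   lambda_n are distinct.  Since r_n(0) = 1 and W_{k,j}(0) = 0 unless
   k = j = 0, summing over n' yields
     w_n(0,0) = sum_{k,j} C_{k,j} w_n(k,j)^2 >= 0. *)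

(** * The polynomials r_{l,m} *)

Section DiskPolynomial.
Variables (F : realFieldType) (Q : F).
Hypotheses (Q_gt0 : 0 < Q) (Q_lt1 : Q < 1).
Implicit Types x : F.

(** The coefficient of x^k in 2phi1(Q^-m, c Q^(l+1); c Q; Q, Q x), taken factor by factor; the
    quotient [Q ^+ i / Q ^+ m] keeps all exponents natural. *)
Definition disk_coef (c : F) (l m k : nat) : F :=
  \prod_(i < k) ((1 - Q ^+ i / Q ^+ m) * (1 - c * Q ^+ (l + i).+1) * Q
                 / ((1 - c * Q ^+ i.+1) * (1 - Q ^+ i.+1))).

Definition disk_poly (c : F) (l m : nat) : {poly F} :=
  \poly_(k < m.+1) disk_coef c l m k.

Lemma Qn_gt0 n : 0 < Q ^+ n. Proof. exact: exprn_gt0. Qed.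

Lemma Qn_neq0 n : Q ^+ n != 0. Proof. by rewrite gt_eqF // Qn_gt0. Qed.

Lemma Q_neq0 : Q != 0. Proof. by rewrite gt_eqF. Qed.

Lemma Qn_le1 n : Q ^+ n <= 1. Proof. by rewrite exprn_ile1 // ltW. Qed.

Lemma oneBQn_gt0 n : 0 < 1 - Q ^+ n.+1.
Proof. by rewrite subr_gt0 exprn_ilt1 // ltW. Qed.

Lemma oneBQn_ge0 n : 0 <= 1 - Q ^+ n.
Proof. by rewrite subr_ge0 Qn_le1. Qed.

Lemma cQn_gt0 c n : 0 < c -> 0 < c * Q ^+ n.
Proof. by move=> ?; rewrite mulr_gt0 ?Qn_gt0. Qed.

Lemma cQn_lt1 c n : 0 < c < 1 -> c * Q ^+ n < 1.
Proof.
by move=> /andP[c0 c1]; rewrite (le_lt_trans _ c1) // ler_piMr ?Qn_le1 // ltW.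
Qed.

Lemma oneBcQn_gt0 c n : 0 < c < 1 -> 0 < 1 - c * Q ^+ n.
Proof. by move=> c01; rewrite subr_gt0 cQn_lt1. Qed.

Lemma cQ_itv c : 0 < c < 1 -> 0 < c * Q < 1.
Proof.
by move=> c01; rewrite -[Q]expr1 cQn_lt1 // cQn_gt0 //; case/andP: c01.
Qed.

Section Coefficients.
Variable c : F.
Hypothesis c01 : 0 < c < 1.
Implicit Types l m k : nat.

Lemma disk_coef0 l m : disk_coef c l m 0 = 1.
Proof. by rewrite /disk_coef big_ord0. Qed.

Lemma disk_coefS l m k :
  disk_coef c l m k.+1 * ((1 - c * Q ^+ k.+1) * (1 - Q ^+ k.+1)) =
  disk_coef c l m k * ((1 - Q ^+ k / Q ^+ m) * (1 - c * Q ^+ (l + k).+1) * Q).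
Proof.
rewrite {1}/disk_coef big_ord_recr /= -/(disk_coef c l m k) -!mulrA.
by rewrite mulVf ?mulr1 // mulf_neq0 // gt_eqF ?oneBcQn_gt0 ?oneBQn_gt0.
Qed.

Lemma disk_coef_eq0 l m : disk_coef c l m m.+1 = 0.
Proof. by rewrite /disk_coef big_ord_recr /= divff ?Qn_neq0 // subrr !mul0r mulr0. Qed.

Lemma disk_coef_neq0 l m k : (k <= m)%N -> disk_coef c l m k != 0.
Proof.
move=> km; apply/prodf_neq0 => -[i ik] _ /=.
have im : (i < m)%N by exact: leq_trans km.
rewrite !mulf_neq0 ?invr_eq0 ?Q_neq0 ?mulf_neq0 //; last first.
- by rewrite gt_eqF ?oneBQn_gt0.
- by rewrite gt_eqF ?oneBcQn_gt0.
- by rewrite gt_eqF ?oneBcQn_gt0.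
have im' : Q ^+ i / Q ^+ m != 1.
  rewrite -(subnKC (ltnW im)) exprD invfM mulrA divff ?Qn_neq0 // mul1r.
  rewrite invr_eq1 lt_eqF // exprn_ilt1 ?ltW //.
  by rewrite -lt0n subn_gt0.
by rewrite subr_eq0 eq_sym.
Qed.

Lemma size_disk_poly l m : size (disk_poly c l m) = m.+1.
Proof. by rewrite size_poly_eq // disk_coef_neq0. Qed.

Lemma disk_polyE l m x :
  (disk_poly c l m).[x] = \sum_(k < m.+1) disk_coef c l m k * x ^+ k.
Proof. by rewrite horner_poly. Qed.

Lemma disk_poly_at0 l m : (disk_poly c l m).[0] = 1.
Proof. by rewrite horner_coef0 coef_poly disk_coef0. Qed.

Lemma sum_telescope (u : nat -> F) n :
  \sum_(k < n) (u k - u k.+1) = u 0%N - u n.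
Proof.
by elim: n => [|n IHn]; rewrite ?big_ord0 ?subrr // big_ord_recr /= IHn; ring.
Qed.

Definition eigenval l m : F := (1 - Q ^+ m) / Q ^+ m * (1 - c * Q ^+ l.+1).

(** The q-difference equation of the 2phi1. Its operator involves [l] and [m] only through l - m, so
    the polynomials r_{n+e,n} with fixed e share one operator. *)
Lemma disk_poly_eigen l m x :
  let f := disk_poly c l m in
  c * (1 - Q ^+ l.+1 / Q ^+ m * x) * (f.[x] - f.[Q * x])
  - (1 - x) * (f.[x / Q] - f.[x]) = eigenval l m * x * f.[x].
Proof.
rewrite /= !disk_polyE; apply/eqP; rewrite -subr_eq0; apply/eqP.
pose t := disk_coef c l m.
(* The difference of the two sides telescopes through [u], which vanishes at [k = 0] and, because
   the series terminates, at [k = m.+1]. *)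
pose u k := - (1 - Q ^+ k) * (1 - c * Q ^+ k) / Q ^+ k * t k * x ^+ k.
transitivity (\sum_(k < m.+1) (u k - u k.+1)); last first.
  by rewrite sum_telescope /u /t disk_coef_eq0 !(mulr0, mul0r); ring.
rewrite -!sumrB !mulr_sumr -!sumrB; apply: eq_bigr => -[k km] _ /=.
have -> : u k.+1 = - (t k.+1 * ((1 - c * Q ^+ k.+1) * (1 - Q ^+ k.+1)))
                     / Q ^+ k.+1 * x ^+ k.+1 by rewrite /u; ring.
rewrite disk_coefS -/(t k) /u /eigenval exprMn expr_div_n -addnS exprD !exprS.
by field; rewrite Q_neq0 !Qn_neq0.
Qed.

End Coefficients.

Variable c : F.
Hypothesis c01 : 0 < c < 1.
Implicit Types l m k : nat.

Lemma disk_coef_theta l m k :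
  disk_coef c l m.+1 k.+1 * ((1 - Q ^+ k.+1) * (1 - c * Q)) =
  disk_coef (c * Q) l m k * ((1 - (Q ^+ m.+1)^-1) * (1 - c * Q ^+ l.+1) * Q).
Proof.
have n1 k' := lt0r_neq0 (oneBcQn_gt0 k' c01).
have n2 k' := lt0r_neq0 (oneBQn_gt0 k').
elim: k => [|k IHk].
  have := disk_coefS c01 l m.+1 0.
  by rewrite !disk_coef0 expr0 addn0 expr1 [(1 - c * Q) * _]mulrC => ->; ring.
apply: (mulIf (mulf_neq0 (n1 k.+2) (n2 k))).
have E1 := disk_coefS c01 l m.+1 k.+1; have E2 := disk_coefS (cQ_itv c01) l m k.
have -> : disk_coef c l m.+1 k.+2 * ((1 - Q ^+ k.+2) * (1 - c * Q)) *
  ((1 - c * Q ^+ k.+2) * (1 - Q ^+ k.+1)) =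
  disk_coef c l m.+1 k.+2 * ((1 - c * Q ^+ k.+2) * (1 - Q ^+ k.+2)) *
  ((1 - Q ^+ k.+1) * (1 - c * Q)) by ring.
have -> : disk_coef (c * Q) l m k.+1 *
    ((1 - (Q ^+ m.+1)^-1) * (1 - c * Q ^+ l.+1) * Q) *
    ((1 - c * Q ^+ k.+2) * (1 - Q ^+ k.+1)) =
  disk_coef (c * Q) l m k.+1 * ((1 - c * Q * Q ^+ k.+1) * (1 - Q ^+ k.+1)) *
    ((1 - (Q ^+ m.+1)^-1) * (1 - c * Q ^+ l.+1) * Q).
  by rewrite !exprS; ring.
rewrite E1 E2 mulrAC IHk !exprS addnS -addSn !addSn !exprS !exprD.
by field; rewrite Q_neq0 !Qn_neq0.
Qed.

(** The q-derivative as a lowering operator that shifts [c] to [c * Q]. At [m = 0] the factor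
    [1 - Q ^+ m] vanishes, which covers the truncated [m.-1]. *)
Lemma disk_poly_theta l m x :
  let f := disk_poly c l m in
  f.[x] - f.[Q * x] =
  - (1 - Q ^+ m) / Q ^+ m * (1 - c * Q ^+ l.+1) * Q / (1 - c * Q) * x
  * (disk_poly (c * Q) l m.-1).[x].
Proof.
have n1 := lt0r_neq0 (oneBcQn_gt0 1 c01).
case: m => [|m] /=.
  by rewrite !disk_polyE !big_ord1 !expr0; ring.
rewrite !disk_polyE -sumrB big_ord_recl !expr0 subrr add0r mulr_sumr.
apply: eq_bigr => -[k km] _ /=; rewrite /bump /= add1n.
apply: (mulIf n1); rewrite expr1.
transitivity (disk_coef c l m.+1 k.+1 * ((1 - Q ^+ k.+1) * (1 - c * Q))
  * x ^+ k.+1); first by rewrite exprMn; ring.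
by rewrite disk_coef_theta !exprS; field; rewrite Q_neq0 Qn_neq0 n1.
Qed.

Lemma disk_coef_cQ l m k :
  disk_coef (c * Q) l m k * (1 - c * Q ^+ k.+1) =
  disk_coef c l.+1 m k * (1 - c * Q).
Proof.
have n1 k' := lt0r_neq0 (oneBcQn_gt0 k' c01).
have n2 k' := lt0r_neq0 (oneBQn_gt0 k').
elim: k => [|k IHk]; first by rewrite !disk_coef0.
apply: (mulIf (mulf_neq0 (n1 k.+1) (n2 k))).
rewrite [RHS]mulrAC disk_coefS // -[RHS]mulrAC -IHk.
rewrite [LHS](_ : _ = disk_coef (c * Q) l m k.+1 *
  ((1 - c * Q * Q ^+ k.+1) * (1 - Q ^+ k.+1)) * (1 - c * Q ^+ k.+1)).
  by rewrite disk_coefS ?cQ_itv // addSn !exprS; ring.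
by rewrite !exprS; ring.
Qed.

(** The operator g(x) - c Q g(Q x) multiplies the k-th coefficient by 1 - c Q^(k+1), and
    [disk_coef_cQ] says what this produces. *)
Lemma disk_poly_raise_l l m x :
  let g := disk_poly (c * Q) l m in
  (1 - c * Q) * (disk_poly c l.+1 m).[x] = g.[x] - c * Q * g.[Q * x].
Proof.
rewrite /= !disk_polyE !mulr_sumr -sumrB; apply: eq_bigr => -[k km] _ /=.
transitivity (disk_coef c l.+1 m k * (1 - c * Q) * x ^+ k); first by ring.
by rewrite -disk_coef_cQ exprMn exprS; ring.
Qed.

(** The q-difference equation of r_{l,m+1} is solved for its value at x, after [disk_poly_theta] at
    [x] and at [x / Q] has replaced the two differences; a common factor [x] is cancelled. *)
Lemma disk_poly_raise_m l m x : x != 0 ->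
  let g := disk_poly (c * Q) l m in
  (1 - c * Q) * (disk_poly c l m.+1).[x] =
  (1 - x) * g.[x / Q] - c * Q * (1 - Q ^+ l / Q ^+ m * x) * g.[x].
Proof.
move=> x0 /=; have n1 := lt0r_neq0 (oneBcQn_gt0 1 c01).
have n2 := lt0r_neq0 (oneBcQn_gt0 l.+1 c01).
have n3 := lt0r_neq0 (oneBQn_gt0 m).
have := disk_poly_eigen c01 l m.+1 x; rewrite /= /eigenval.
have /= E1 := disk_poly_theta l m.+1 x; have /= E2 := disk_poly_theta l m.+1 (x / Q).
rewrite mulrCA divff ?Q_neq0 // mulr1 in E2.
rewrite E1 E2; set g0 := (disk_poly _ _ _).[x]; set g1 := (disk_poly _ _ _).[_].
set f := (disk_poly c _ _).[x] => E.
rewrite expr1 in n1.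
have n4 := Qn_neq0 m.
apply: (mulfI (mulf_neq0 (mulf_neq0 n2 n3) x0)).
apply: (mulIf (invr_neq0 (Qn_neq0 m.+1))).
transitivity ((1 - Q ^+ m.+1) / Q ^+ m.+1 * (1 - c * Q ^+ l.+1) * x * f * (1 - c * Q)).
  by ring.
by rewrite -E !exprS; field; rewrite Q_neq0 n4 n1.
Qed.

(** The second lowering operator, which lowers [l] instead of [m]. It follows by telescoping once
    [disk_coef_cQ] has expressed the right-hand side through the coefficients for [c]; the factor
    [1 - Q ^+ l] covers the truncated [l.-1]. *)
Lemma disk_poly_partial l m x :
  let f := disk_poly c l m in
  (1 - Q * x) * f.[x] - (1 - Q ^+ l.+1 / Q ^+ m * x) * f.[Q * x] =
  - (1 - Q ^+ l) / Q ^+ m * (1 - c * Q ^+ m.+1) / (1 - c * Q) * (Q * x)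
  * (disk_poly (c * Q) l.-1 m).[Q * x].
Proof.
rewrite /= !disk_polyE; apply/eqP; rewrite -subr_eq0; apply/eqP.
pose t := disk_coef c l m.
pose u k := (1 - Q ^+ k) * t k * x ^+ k.
transitivity (\sum_(k < m.+1) (u k - u k.+1)); last first.
  by rewrite sum_telescope /u /t disk_coef_eq0 !(mulr0, mul0r); ring.
rewrite !mulr_sumr -!sumrB; apply: eq_bigr => -[k km] _ /=.
have n1 k' := lt0r_neq0 (oneBcQn_gt0 k' c01).
have -> : u k.+1 = (t k.+1 * ((1 - c * Q ^+ k.+1) * (1 - Q ^+ k.+1)))
                     / (1 - c * Q ^+ k.+1) * x ^+ k.+1.
  by rewrite /u; field.
have n2 := n1 1; rewrite expr1 in n2.
have n3 := n1 k.+1; rewrite exprS in n3.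
rewrite disk_coefS // -/(t k) /u.
have E : (1 - Q ^+ l) * disk_coef (c * Q) l.-1 m k =
   (1 - Q ^+ l) * (t k * (1 - c * Q)) / (1 - c * Q ^+ k.+1).
  case: l @t @u => [|l] t u; first by rewrite expr0 subrr !mul0r.
  by rewrite -[l.+1.-1]/l /t -disk_coef_cQ !mulrA mulfK.
rewrite [X in _ - X](_ : _ = - ((1 - Q ^+ l) * disk_coef (c * Q) l.-1 m k)
  / Q ^+ m * (1 - c * Q ^+ m.+1) / (1 - c * Q) * (Q * x) * (Q * x) ^+ k);
  last by ring.
rewrite E !exprMn -addnS exprD !exprS.
by field; rewrite Qn_neq0 n2 n3.
Qed.

Lemma disk_poly_m0 l : disk_poly c l 0 = 1.
Proof.
by apply/polyP=> k; rewrite coef_poly coef1; case: k => [|k]; rewrite ?disk_coef0.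
Qed.

End DiskPolynomial.

(** * Euler's transformation between r_{l,m} and r_{m,l} *)

Section EulerTransformation.
Variables (F : realFieldType) (Q : F).
Hypotheses (Q_gt0 : 0 < Q) (Q_lt1 : Q < 1).
Implicit Types (c x : F) (l b : nat).

Let qfall b x := \prod_(i < b) (1 - x / Q ^+ i).

Let qfallS b x : qfall b.+1 x = qfall b x * (1 - x / Q ^+ b).
Proof. by rewrite /qfall big_ord_recr. Qed.

Let qfallSl b x : qfall b.+1 x = (1 - x) * qfall b (x / Q).
Proof.
rewrite /qfall big_ord_recl expr0 divr1; congr (_ * _).
by apply: eq_bigr => i _; rewrite lift0 exprS invfM mulrA.
Qed.

(* Both sides are obtained from the parameter c Q: the left-hand side by raising
   l, the right-hand side by raising m. *)
Lemma disk_poly_euler l b c x : 0 < c < 1 -> x != 0 ->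
  (disk_poly Q c l (l + b)).[x] =
  \prod_(i < b) (1 - x / Q ^+ i) * (disk_poly Q c (l + b) l).[x / Q ^+ b].
Proof.
rewrite -/(qfall b x).
have Q0 : Q != 0 by rewrite gt_eqF.
(* [c] and [x] stay general because raising replaces [c] by [c * Q] and evaluates at a shifted
   argument. For [l = 0] an inner induction on [b] identifies r_{0,b} with the product. *)
elim: l b c x => [|l IHl] b c x c01 x0.
  rewrite add0n disk_poly_m0 // hornerC mulr1.
  elim: b c x c01 x0 => [|b IHb] c x c01 x0.
    by rewrite disk_poly_m0 // hornerC /qfall big_ord0.
  have n1 := lt0r_neq0 (oneBcQn_gt0 Q_gt0 Q_lt1 1 c01); rewrite expr1 in n1.
  apply: (mulfI n1); rewrite disk_poly_raise_m // !IHb ?cQ_itv //.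
    rewrite -qfallSl expr0 mul1r mulrAC -mulrA [(1 - _) * _]mulrC.
    by rewrite [_^-1 * x]mulrC -qfallS; ring.
  by rewrite mulf_neq0 ?invr_eq0.
have n1 := lt0r_neq0 (oneBcQn_gt0 Q_gt0 Q_lt1 1 c01); rewrite expr1 in n1.
apply: (mulfI n1); rewrite disk_poly_raise_l // addSn -addnS !IHl ?cQ_itv ?mulf_neq0 //.
rewrite [RHS]mulrCA disk_poly_raise_m ?mulf_neq0 ?invr_eq0 ?expf_neq0 // addnS.
rewrite qfallS (_ : qfall b.+1 (Q * x) = qfall b x * (1 - Q * x)); last first.
  by rewrite qfallSl mulrC [Q * x]mulrC mulfK.
rewrite (_ : Q * x / Q ^+ b.+1 = x / Q ^+ b); last first.
  by rewrite exprS; field; rewrite Q0 expf_neq0.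
rewrite (_ : x / Q ^+ b.+1 = x / Q ^+ b / Q); last first.
  by rewrite exprS; field; rewrite Q0 expf_neq0.
rewrite (_ : Q ^+ (l + b).+1 / Q ^+ l * (x / Q ^+ b) = Q * x); last first.
  by rewrite exprS exprD; field; rewrite !expf_neq0.
by ring.
Qed.

End EulerTransformation.

(** * The q-difference operator on a product of two factors *)

Section KeyIdentity.
Variable F : realFieldType.

(* A1, A0, Am (B1, B0, Bm) stand for the values of a factor at Q Y, Y, Y / Q
   (at Q X, X, X / Q).  The q-difference equations of the two factors leave one
   free parameter in this decomposition; it is fixed so that x1 vanishes at
   j = 0 (v = 1) and y1 vanishes at k = 0 (u = 1). *)
Lemma product_qdifference (Q a u v X y b A0 A1 Am B0 B1 Bm lA lB : F) :
  u != 0 -> v != 0 -> 1 - a * (u * v) != 0 ->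
  let c := a * (u * v) in
  let x1 := - (v^-1 - 1) / (1 - c) in
  let x2 := - c * (1 - a * u) / (1 - c) in
  let y1 := - (v^-1 * (u^-1 - 1)) / (1 - c) in
  let y2 := - (v^-1 * (1 - a * v)) / (1 - c) in
  let Y := y * X in
  let V := b * X in
  let J0 := - a * Q * b - 1 + (x1 + x2) * Q * y + (c ^+ 2 * y1 + y2) * y
            + v^-1 * (c * Q * b + y + c * Q * y + 1 + lA * y + lB) in
  c * (1 - Q * V) * (A0 - A1) - (1 - Y) * (Am - A0) = lA * Y * A0 ->
  c * (1 - Q * Y) * (B0 - B1) - (1 - X) * (Bm - B0) = lB * X * B0 ->
  a * (1 - Q * V) * (A0 * B0 - u * v * (A1 * B1))
  - (1 - X) * (Am * Bm / (u * v) - A0 * B0) =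
  x1 * (((1 - Q * Y) * A0 - c * (1 - Q * V) * A1) * (B0 - c * B1))
  + x2 * (((1 - Q * Y) * A0 - (1 - Q * V) * A1) * (B0 - B1))
  + y1 * ((Am - c * A0) * ((1 - X) * Bm - c * (1 - Y) * B0))
  + y2 * ((Am - A0) * ((1 - X) * Bm - (1 - Y) * B0))
  + J0 * X * (A0 * B0).
Proof.
move=> u0 v0 c1 c x1 x2 y1 y2 Y V J0 EA EB; apply/eqP; rewrite -subr_eq0.
pose DA := c * (1 - Q * V) * (A0 - A1) - (1 - Y) * (Am - A0) - lA * Y * A0.
pose DB := c * (1 - Q * Y) * (B0 - B1) - (1 - X) * (Bm - B0) - lB * X * B0.
rewrite [X in X == 0](_ : _ = v^-1 * (DA * B0 + DB * A0)).
  by rewrite /DA /DB EA EB !subrr !mul0r addr0 mulr0.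
rewrite /DA /DB /J0 /x1 /x2 /y1 /y2 /Y /V /c.
by field; rewrite u0 v0 c1.
Qed.
End KeyIdentity.

(** * Triangular bases and ladder sums *)

Section TriangularBasis.
Variables (F : fieldType) (p : nat -> {poly F}).
Hypothesis size_p : forall n, size (p n) = n.+1.

Let lead_p n : (p n)`_n != 0.
Proof.
have := size_p n; case: (eqVneq (p n) 0) => [->|p0 sp]; first by rewrite size_poly0.
by rewrite -[X in _`_X]/(n.+1.-1) -sp -/(lead_coef _) lead_coef_eq0.
Qed.

Lemma triangular_expansion N (f : {poly F}) : (size f <= N)%N ->
  exists w : nat -> F, f = \sum_(n < N) w n *: p n.
Proof.
elim: N f => [|N IHN] f sf.
  by exists (fun=> 0); rewrite big_ord0; apply/size_poly_leq0P.
pose x := f`_N / (p N)`_N.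
have [|w Ew] := IHN (f - x *: p N).
  apply/leq_sizeP => k; rewrite leq_eqVlt => /predU1P[<-|Nk].
    by rewrite coefB coefZ /x divfK // subrr.
  by rewrite coefB coefZ !nth_default ?mulr0 ?subr0 ?size_p //; exact: leq_trans Nk.
exists (fun n => if n == N then x else w n).
rewrite big_ord_recr /= eqxx -[f in LHS](subrK (x *: p N)) Ew; congr (_ + _).
by apply: eq_bigr => i _; rewrite ltn_eqF.
Qed.

Lemma triangular_free N (w : nat -> F) :
  \sum_(n < N) w n *: p n = 0 -> forall n, (n < N)%N -> w n = 0.
Proof.
elim: N => // N IHN; rewrite big_ord_recr /= => E.
have wN : w N = 0.
  have := congr1 (fun f : {poly F} => f`_N) E; rewrite coefD coefZ coef0.
  rewrite nth_default ?add0r.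
    by move/eqP; rewrite mulf_eq0 (negPf (lead_p N)) orbF => /eqP.
  apply: (leq_trans (size_sum _ _ _)); apply/bigmax_leqP => i _.
  by rewrite (leq_trans (size_scale_leq _ _)) // size_p.
rewrite wN scale0r addr0 in E.
by move=> n; rewrite ltnS leq_eqVlt => /predU1P[->//|]; exact: IHN.
Qed.
End TriangularBasis.

(** The powers of Q are pairwise distinct, hence give infinitely many roots. The bound [n0] is there
    because operator identities are compared only at Q^n with n large. *)
Lemma poly_eq0_on_powers (F : realFieldType) (Q : F) (p : {poly F}) n0 :
  0 < Q -> Q < 1 -> (forall n, (n0 <= n)%N -> p.[Q ^+ n] = 0) -> p = 0.
Proof.
move=> Q0 Q1 p0; apply/eqP; apply/negP => /negP pN0.
pose rs := [seq Q ^+ i | i <- iota n0 (size p)].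
have := max_poly_roots pN0 (rs := rs); rewrite size_map size_iota ltnn => H.
suff: false by []; apply: H.
  by apply/allP => _ /mapP[i + ->]; rewrite mem_iota => /andP[? _]; apply/rootP/p0.
by rewrite map_inj_uniq ?iota_uniq //; apply: ieexprIn; rewrite // lt_eqF.
Qed.

(** Summation by parts under detailed balance: both sides equal the sum of c_k u_k (f_{k+1} g_k +
    f_k g_{k+1}). The boundary conditions remove the terms with [K.+1] and with [0.-1]. *)
Lemma ladder_sum_sym (F : comRingType) K (c u d f g : nat -> F) :
  (forall k, (k < K)%N -> c k * u k = c k.+1 * d k.+1) ->
  u K = 0 -> d 0%N = 0 ->
  \sum_(k < K.+1) c k * (u k * f k.+1 + d k * f k.-1) * g k =
  \sum_(k < K.+1) c k * (u k * g k.+1 + d k * g k.-1) * f k.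
Proof.
move=> cud uK d0.
have E (f' g' : nat -> F) : \sum_(k < K.+1) c k * (u k * f' k.+1 + d k * f' k.-1) * g' k =
    \sum_(k < K) c k * u k * (f' k.+1 * g' k + f' k * g' k.+1).
  under eq_bigr do rewrite mulrDr mulrDl.
  rewrite big_split big_ord_recr big_ord_recl /= uK d0 !(mul0r, mulr0) addr0 add0r.
  rewrite -big_split /=; apply: eq_bigr => -[k kK] _ /=.
  by rewrite -[bump 0 k]/k.+1 add0n [c k.+1 * _]mulrA -cud //; ring.
by rewrite !E; apply: eq_bigr => k _; ring.
Qed.

(** * Positivity for the polynomials r_{l,m} *)

Section Positivity.
Variables (F : realFieldType) (Q a : F).
Hypotheses (Q_gt0 : 0 < Q) (Q_lt1 : Q < 1) (a01 : 0 < a < 1).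
Variables l m l' m' : nat.

Let R := disk_poly Q.
Let A k j := R (a * Q ^+ (k + j)) (l - k) (m - j).
Let B k j := R (a * Q ^+ (k + j)) (l' - j) (m' - k).
Let y k j : F := Q ^+ (l' - j) / Q ^+ (m' - k).

(* The product R_{l,m} R_{l',m'}, with no involution on the second factor, is
   the case k = j = 0. *)
Definition ladder_poly k j : {poly F} :=
  (A k j \Po ((y k j)%:P * 'X)) * 'X^(k + j) * B k j.

Lemma ladder_polyE k j (x : F) :
  (ladder_poly k j).[x] = (A k j).[y k j * x] * x ^+ (k + j) * (B k j).[x].
Proof. by rewrite !hornerM horner_comp hornerCM hornerX hornerXn. Qed.

(** [theta] and [kappa] are the constants of [disk_poly_theta] and [disk_poly_partial]; [x1], [x2],
    [y1], [y2] are those of [product_qdifference] with u = Q^k and v = Q^j. *)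
Let theta (c : F) l m : F :=
  - (1 - Q ^+ m) / Q ^+ m * (1 - c * Q ^+ l.+1) * Q / (1 - c * Q).
Let kappa (c : F) l m : F :=
  - (1 - Q ^+ l) / Q ^+ m * (1 - c * Q ^+ m.+1) / (1 - c * Q).

Let c k j : F := a * (Q ^+ k * Q ^+ j).
Let x1 k j : F := - ((Q ^+ j)^-1 - 1) / (1 - c k j).
Let x2 k j : F := - c k j * (1 - a * Q ^+ k) / (1 - c k j).
Let y1 k j : F := - ((Q ^+ j)^-1 * ((Q ^+ k)^-1 - 1)) / (1 - c k j).
Let y2 k j : F := - ((Q ^+ j)^-1 * (1 - a * Q ^+ j)) / (1 - c k j).

(** An upward move lowers both factors and collects two lowering constants; a downward move raises
    both, and each raising formula contributes one factor [1 - c k j]. *)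
Definition k_up k j : F := x2 k j * (Q * y k j) *
  kappa (c k j) (l - k) (m - j) * theta (c k j) (l' - j) (m' - k).
Definition j_up k j : F := y2 k j * (y k j / Q) *
  theta (c k j) (l - k) (m - j) * kappa (c k j) (l' - j) (m' - k).
Definition k_down k j : F := y1 k j * (1 - c k j) ^+ 2.
Definition j_down k j : F := x1 k j * (1 - c k j) ^+ 2.

Let a_gt0 : 0 < a. Proof. by case/andP: a01. Qed.
Let Q0 := Q_neq0 Q_gt0.
Let Qn := Qn_neq0 Q_gt0.

Let cE k j : c k j = a * Q ^+ (k + j). Proof. by rewrite exprD. Qed.

Let c_itv k j : 0 < c k j < 1.
Proof. by rewrite cE cQn_gt0 ?cQn_lt1. Qed.

Let c_lt1 k j : 0 < 1 - c k j.
Proof. by rewrite subr_gt0; case/andP: (c_itv k j). Qed.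

Let c_neq1 k j : 1 - c k j != 0. Proof. by rewrite gt_eqF. Qed.

(** * The little q-Jacobi operator on the ladder products *)

Variable e : nat.
Hypothesis weight : (l + l' = e + m + m')%N.

(** This is [x] times the little q-Jacobi operator whose eigenfunctions are the r_{n+e,n}. *)
Definition qdiff (f : {poly F}) (x : F) : F :=
  a * (1 - Q * (Q ^+ e * x)) * (f.[x] - f.[Q * x])
  - (1 - x) * (f.[x / Q] - f.[x]).

(** Each of the four product terms in [product_qdifference] consists of two first-order expressions,
    one per factor, and a pair of lowering or raising formulas turns it into one neighbour. *)
Lemma qdiff_ladder k j : (k <= l)%N -> (k <= m')%N -> (j <= m)%N -> (j <= l')%N ->
  exists d0, forall x : F, x != 0 ->
  qdiff (ladder_poly k j) x =
  x * (d0 * (ladder_poly k j).[x]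
       + (k_up k j * (ladder_poly k.+1 j).[x] + k_down k j * (ladder_poly k.-1 j).[x])
       + (j_up k j * (ladder_poly k j.+1).[x] + j_down k j * (ladder_poly k j.-1).[x])).
Proof.
move=> kl km' jm jl'.
set L := (l - k)%N; set M := (m - j)%N; set L' := (l' - j)%N; set M' := (m' - k)%N.
pose cc := c k j.
have yE : y k j = Q ^+ L' / Q ^+ M' by [].
have bE : Q ^+ e = Q ^+ L / Q ^+ M * y k j.
  rewrite yE; apply: (mulIf (mulf_neq0 (Qn M) (Qn M'))).
  rewrite -!exprD (_ : e + (M + M') = L + L')%N.
    by rewrite !exprD; field; rewrite !Qn.
  by rewrite /L /L' /M /M'; lia.
pose lA := eigenval Q cc L M; pose lB := eigenval Q cc L' M'.
(* This is [J0] of [product_qdifference] with [b = Q ^+ e] and [y = y k j]. *)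
exists (- a * Q * Q ^+ e - 1 + (x1 k j + x2 k j) * Q * y k j
    + (cc ^+ 2 * y1 k j + y2 k j) * y k j
    + (Q ^+ j)^-1 * (cc * Q * Q ^+ e + y k j + cc * Q * y k j + 1 + lA * y k j + lB)).
move=> x x0; set d0 := (X in X * _ + _).
pose A0 := (A k j).[y k j * x]; pose A1 := (A k j).[Q * (y k j * x)].
pose Am := (A k j).[y k j * x / Q].
pose B0 := (B k j).[x]; pose B1 := (B k j).[Q * x]; pose Bm := (B k j).[x / Q].
have y0 : y k j != 0 by rewrite mulf_neq0 ?invr_eq0.
have yx0 : y k j * x != 0 by rewrite mulf_neq0.
have EA : cc * (1 - Q * (Q ^+ e * x)) * (A0 - A1) - (1 - y k j * x) * (Am - A0)
    = lA * (y k j * x) * A0.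
  have := disk_poly_eigen Q_gt0 Q_lt1 (c_itv k j) L M (y k j * x).
  rewrite /= /A0 /A1 /Am /A -!cE => <-; congr (_ * (1 - _) * _ - _).
  by rewrite bE exprS; ring.
have EB : cc * (1 - Q * (y k j * x)) * (B0 - B1) - (1 - x) * (Bm - B0)
    = lB * x * B0.
  have := disk_poly_eigen Q_gt0 Q_lt1 (c_itv k j) L' M' x.
  rewrite /= /B0 /B1 /Bm /B -!cE => <-; congr (_ * (1 - _) * _ - _).
  by rewrite yE exprS; ring.
have E : a * (1 - Q * (Q ^+ e * x)) * (A0 * B0 - Q ^+ k * Q ^+ j * (A1 * B1))
    - (1 - x) * (Am * Bm / (Q ^+ k * Q ^+ j) - A0 * B0) =
  x1 k j * (((1 - Q * (y k j * x)) * A0 - cc * (1 - Q * (Q ^+ e * x)) * A1)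
            * (B0 - cc * B1))
  + x2 k j * (((1 - Q * (y k j * x)) * A0 - (1 - Q * (Q ^+ e * x)) * A1) * (B0 - B1))
  + y1 k j * ((Am - cc * A0) * ((1 - x) * Bm - cc * (1 - y k j * x) * B0))
  + y2 k j * ((Am - A0) * ((1 - x) * Bm - (1 - y k j * x) * B0))
  + d0 * x * (A0 * B0)
  := product_qdifference (Qn k) (Qn j) (c_neq1 k j) EA EB.
have AE : disk_poly Q cc L M = A k j by rewrite /cc cE.
have BE : disk_poly Q cc L' M' = B k j by rewrite /cc cE.
have cQE : cc * Q = a * Q ^+ (k + j).+1 by rewrite /cc cE exprSr mulrA.
have Y' : y k j * x / Q = y k j * (x / Q) by rewrite mulrA.
have Y'' : Q * (y k j * x) = y k j * (Q * x) by rewrite mulrCA.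
have QYV : Q ^+ L.+1 / Q ^+ M * (y k j * x) = Q * (Q ^+ e * x).
  by rewrite bE exprS; ring.
have T1 : x ^+ (k + j) *
   (x2 k j * (((1 - Q * (y k j * x)) * A0 - (1 - Q * (Q ^+ e * x)) * A1) * (B0 - B1)))
   = x * (k_up k j * (ladder_poly k.+1 j).[x]).
  have := disk_poly_partial Q_gt0 Q_lt1 (c_itv k j) L M (y k j * x).
  rewrite /= QYV -!/cc {1 2}/cc cE -/R -/(A k j) -/A0 -/A1 => ->.
  have := disk_poly_theta Q_gt0 Q_lt1 (c_itv k j) L' M' x.
  rewrite /= {1 2}cE -/R -/(B k j) -/B0 -/B1 => ->.
  rewrite ladder_polyE /A /B /k_up -/cc.
  rewrite addSn -cQE !subnS -/L -/M -/L' -/M'.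
  (* For [M' = 0] the rule [y k.+1 j = Q * y k j] fails under truncated subtraction, but then
     [theta] vanishes. *)
  case: (posnP M') => [M'0|M'gt0].
    by rewrite /theta -/M' M'0 expr0; ring.
  have -> : y k.+1 j = Q * y k j.
    rewrite /y subnS -/L' -/M' -(prednK M'gt0) exprS /=; field; rewrite Q0 Qn //.
  rewrite /kappa /theta !exprS [Q * (y k j * x)]mulrA.
  by clearbody cc L M L' M'; ring.
have T3 : x ^+ (k + j) *
   (y2 k j * ((Am - A0) * ((1 - x) * Bm - (1 - y k j * x) * B0)))
   = x * (j_up k j * (ladder_poly k j.+1).[x]).
  have := disk_poly_theta Q_gt0 Q_lt1 (c_itv k j) L M (y k j * x / Q).
  rewrite /= [Q * (_ / Q)]mulrC divfK // {1 2}cE -/R -/(A k j) -/A0 -/Am => ->.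
  have := disk_poly_partial Q_gt0 Q_lt1 (c_itv k j) L' M' (x / Q).
  have -> : Q ^+ L'.+1 / Q ^+ M' * (x / Q) = y k j * x.
    by rewrite yE exprS; field; rewrite Q0 Qn.
  rewrite /= [Q * (_ / Q)]mulrC divfK // {1 2}cE -/R -/(B k j) -/B0 -/Bm => ->.
  rewrite ladder_polyE /A /B /j_up -/cc.
  rewrite addnS -cQE !subnS -/L -/M -/L' -/M'.
  case: (posnP L') => [L'0|L'gt0].
    by rewrite /kappa -/L' L'0 expr0; ring.
  have -> : y k j.+1 = y k j / Q.
    by rewrite /y subnS -/L' -/M' -(prednK L'gt0) exprS /=; field; rewrite Q0 Qn.
  rewrite /kappa /theta !exprS [_ / Q * x]mulrAC.
  by clearbody cc L M L' M'; ring.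
have T2 : x ^+ (k + j) *
   (y1 k j * ((Am - cc * A0) * ((1 - x) * Bm - cc * (1 - y k j * x) * B0)))
   = x * (k_down k j * (ladder_poly k.-1 j).[x]).
  (* Raising starts from the parameter [c k j / Q], available for [k > 0] only; at [k = 0] the
     constant [y1] is zero. *)
  case: (posnP k) => [k0|kgt0].
    have y10 : y1 k j = 0 by rewrite /y1 k0 expr0 invr1 subrr mulr0 oppr0 mul0r.
    by rewrite /k_down y10 !(mul0r, mulr0).
  pose c0 := a * Q ^+ (k.-1 + j).
  have c0Q : c0 * Q = cc by rewrite /c0 -mulrA -exprSr -addSn prednK // -cE.
  have c01 : 0 < c0 < 1 by rewrite /c0 -cE.
  have := disk_poly_raise_l Q_gt0 Q_lt1 c01 L M (y k j * x / Q).
  rewrite /= c0Q [Q * (_ / Q)]mulrC divfK // AE -/A0 -/Am => <-.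
  have := disk_poly_raise_m Q_gt0 Q_lt1 c01 L' M' x0.
  rewrite /= c0Q -yE BE -/B0 -/Bm => <-.
  rewrite ladder_polyE /A /B /k_down -/cc -/c0.
  have -> : (l - k.-1 = L.+1)%N by rewrite /L -subSn // -{2}(prednK kgt0) subSS.
  have M'S : (m' - k.-1 = M'.+1)%N by rewrite /M' -subSn // -{2}(prednK kgt0) subSS.
  rewrite M'S -/L' -/M.
  have -> : y k.-1 j = y k j / Q.
    by rewrite /y M'S -/L' -/M' exprS; field; rewrite Q0 Qn.
  have -> : x ^+ (k + j) = x * x ^+ (k.-1 + j) by rewrite -exprS -addSn prednK.
  rewrite [_ / Q * x]mulrAC.
  by clearbody c0 cc L M L' M'; ring.
have T4 : x ^+ (k + j) *
   (x1 k j * (((1 - Q * (y k j * x)) * A0 - cc * (1 - Q * (Q ^+ e * x)) * A1)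
              * (B0 - cc * B1)))
   = x * (j_down k j * (ladder_poly k j.-1).[x]).
  case: (posnP j) => [j0|jgt0].
    have x10 : x1 k j = 0 by rewrite /x1 j0 expr0 invr1 subrr oppr0 mul0r.
    by rewrite /j_down x10 !(mul0r, mulr0).
  pose c0 := a * Q ^+ (k + j.-1).
  have c0Q : c0 * Q = cc by rewrite /c0 -mulrA -exprSr -addnS prednK // -cE.
  have c01 : 0 < c0 < 1 by rewrite /c0 -cE.
  have Qyx0 : Q * (y k j * x) != 0 by rewrite mulf_neq0.
  have := disk_poly_raise_m Q_gt0 Q_lt1 c01 L M Qyx0.
  have -> : Q ^+ L / Q ^+ M * (Q * (y k j * x)) = Q * (Q ^+ e * x).
    by rewrite -QYV exprS; ring.
  rewrite /= c0Q [Q * (_ * _) / Q]mulrC mulKf // AE -/A0 -/A1 => <-.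
  have := disk_poly_raise_l Q_gt0 Q_lt1 c01 L' M' x.
  rewrite /= c0Q BE -/B0 -/B1 => <-.
  rewrite ladder_polyE /A /B /j_down -/cc -/c0.
  have -> : (m - j.-1 = M.+1)%N by rewrite /M -subSn // -{2}(prednK jgt0) subSS.
  have L'S : (l' - j.-1 = L'.+1)%N by rewrite /L' -subSn // -{2}(prednK jgt0) subSS.
  rewrite L'S -/L -/M'.
  have -> : y k j.-1 = Q * y k j.
    by rewrite /y L'S -/L' -/M' exprS; ring.
  have -> : x ^+ (k + j) = x * x ^+ (k + j.-1) by rewrite -exprS -addnS prednK.
  rewrite [Q * (y k j * x)]mulrA.
  by clearbody c0 cc L M L' M'; ring.
transitivity (x ^+ (k + j) *
    (a * (1 - Q * (Q ^+ e * x)) * (A0 * B0 - Q ^+ k * Q ^+ j * (A1 * B1))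
    - (1 - x) * (Am * Bm / (Q ^+ k * Q ^+ j) - A0 * B0))).
  rewrite /qdiff !ladder_polyE -Y' -Y'' -/A0 -/A1 -/Am -/B0 -/B1 -/Bm.
  by rewrite exprMn expr_div_n !exprD; field; rewrite !Qn.
rewrite E 4!(mulrDr (x ^+ (k + j))) T1 T2 T3 T4 (ladder_polyE k j) -/A0 -/B0.
by clearbody d0; ring.
Qed.


(** * Signs, boundary values and symmetrizing weights *)

Let K := minn l m'.
Let J := minn m l'.

Let oneBQ_ge0 n : 0 <= 1 - Q ^+ n. Proof. exact: oneBQn_ge0. Qed.
Let oneBaQ_gt0 n : 0 < 1 - a * Q ^+ n. Proof. exact: oneBcQn_gt0. Qed.

Let theta_le0 k j i n : theta (c k j) i n <= 0.
Proof.
have h i' := ltW (oneBcQn_gt0 Q_gt0 Q_lt1 i' (c_itv k j)).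
have := h 1%N; rewrite expr1 /theta !mulNr oppr_le0 => h1.
by rewrite !mulr_ge0 ?invr_ge0 ?exprn_ge0 ?(ltW Q_gt0).
Qed.

Let kappa_le0 k j i n : kappa (c k j) i n <= 0.
Proof.
have h i' := ltW (oneBcQn_gt0 Q_gt0 Q_lt1 i' (c_itv k j)).
have := h 1%N; rewrite expr1 /kappa !mulNr oppr_le0 => h1.
by rewrite !mulr_ge0 ?invr_ge0 ?exprn_ge0 ?(ltW Q_gt0).
Qed.

Let Qy_ge0 k j : 0 <= y k j.
Proof. by rewrite /y mulr_ge0 ?invr_ge0 ?exprn_ge0 ?(ltW Q_gt0). Qed.

(* This sign and the next one need 1 - a > 0, that is alpha > 0. *)
Lemma k_up_le0 k j : k_up k j <= 0.
Proof.
rewrite /k_up -mulrA mulr_le0_ge0 ?mulr_le0 ?theta_le0 ?kappa_le0 //.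
rewrite mulr_le0_ge0 ?(mulr_ge0 (ltW Q_gt0) (Qy_ge0 k j)) //.
have /andP[/ltW c_ge0 _] := c_itv k j.
by rewrite /x2 !mulNr oppr_le0 divr_ge0 ?(mulr_ge0 c_ge0) ?(ltW (oneBaQ_gt0 k))
  ?(ltW (c_lt1 k j)).
Qed.

Lemma j_up_le0 k j : j_up k j <= 0.
Proof.
rewrite /j_up -mulrA mulr_le0_ge0 ?mulr_le0 ?theta_le0 ?kappa_le0 //.
rewrite mulr_le0_ge0 ?(divr_ge0 (Qy_ge0 k j) (ltW Q_gt0)) //.
by rewrite /y2 !mulNr oppr_le0 !mulr_ge0 ?invr_ge0 ?exprn_ge0 ?(ltW (oneBaQ_gt0 _))
  ?(ltW (c_lt1 _ _)) ?(ltW Q_gt0).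
Qed.

Let invQ_gt1 k : 0 < (Q ^+ k.+1)^-1 - 1.
Proof. by rewrite subr_gt0 invf_gt1 ?exprn_gt0 // -subr_gt0 oneBQn_gt0. Qed.

Lemma k_down_lt0 k j : k_down k.+1 j < 0.
Proof.
rewrite /k_down /y1 !mulNr oppr_lt0.
by rewrite !mulr_gt0 ?invr_gt0 ?invQ_gt1 ?exprn_gt0 ?c_lt1.
Qed.

Lemma j_down_lt0 k j : j_down k j.+1 < 0.
Proof.
rewrite /j_down /x1 !mulNr oppr_lt0.
by rewrite !mulr_gt0 ?invr_gt0 ?invQ_gt1 ?exprn_gt0 ?c_lt1.
Qed.

(** At [k = K] one of [l - k] and [m' - k] is 0, which gives a factor 1 - Q^0. Together with the
    next three lemmas this confines the recurrence to the rectangle k <= K, j <= J. *)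
Lemma k_up_last j : k_up K j = 0.
Proof.
rewrite /k_up /kappa /theta /K.
case: (leqP l m') => _; rewrite subnn expr0 subrr oppr0 !mul0r ?mulr0 ?mul0r //.
Qed.

Lemma j_up_last k : j_up k J = 0.
Proof.
rewrite /j_up /kappa /theta /J.
case: (leqP m l') => _; rewrite subnn expr0 subrr oppr0 !mul0r ?mulr0 ?mul0r //.
Qed.

Lemma k_down0 j : k_down 0 j = 0.
Proof. by rewrite /k_down /y1 expr0 invr1 subrr mulr0 oppr0 !mul0r. Qed.

Lemma j_down0 k : j_down k 0 = 0.
Proof. by rewrite /j_down /x1 expr0 invr1 subrr oppr0 !mul0r. Qed.

Let oneBQ k : 1 - Q ^+ k.+1 != 0. Proof. by rewrite gt_eqF ?oneBQn_gt0. Qed.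

Let k_ratio k j := k_up k j / k_down k.+1 j.
Let j_ratio k j := j_up k j / j_down k j.+1.

(** The two ways around a unit square accumulate the same ratio, so that a single weight can satisfy
    detailed balance in both directions. *)
Lemma ratio_comm k j : (k < K)%N -> (j < J)%N ->
  k_ratio k j * j_ratio k.+1 j = j_ratio k j * k_ratio k j.+1.
Proof.
rewrite /K /J !leq_min => /andP[kl km'] /andP[jm jl'].
rewrite /k_ratio /j_ratio /k_up /k_down /j_up /j_down /x1 /x2 /y1 /y2 /y /kappa /theta.
have := c_neq1 k j; have := c_neq1 k.+1 j.
have := c_neq1 k j.+1; have := c_neq1 k.+1 j.+1.
rewrite /c.
rewrite -(subnSK kl) -(subnSK km') -(subnSK jm) -(subnSK jl').
move: (l - k.+1)%N (m' - k.+1)%N (m - j.+1)%N (l' - j.+1)%N => L M' M L'.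
rewrite !exprS.
have := oneBQ k; have := oneBQ j; rewrite !exprS.
have := Qn k; have := Qn j; have := Qn L; have := Qn M; have := Qn L'; have := Qn M'.
move: (Q ^+ k) (Q ^+ j) (Q ^+ L) (Q ^+ M) (Q ^+ L') (Q ^+ M') => qk qj qL qM qL' qM'.
move=> hM' hL' hM hL hj hk hj' hk' h4 h3 h2 h1.
field; rewrite !mulN1r; rewrite !Q0 hk hj hM hM' hk' hj' h1 h3 /=.
by rewrite ?h1 ?h2 ?h3 ?h4.
Qed.

(** The ratios are accumulated along the path from (0,0) through (k,0) to (k,j); [ratio_comm] makes
    this choice of path immaterial. *)
Let C k j := \prod_(i < k) k_ratio i 0 * \prod_(i < j) j_ratio k i.

Let C_down_j k j : C k j.+1 * j_down k j.+1 = C k j * j_up k j.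
Proof.
by rewrite /C big_ord_recr /= mulrA -[LHS]mulrA /j_ratio divfK // lt_eqF ?j_down_lt0.
Qed.

Let CS k j : (k < K)%N -> (j <= J)%N -> C k.+1 j = C k j * k_ratio k j.
Proof.
move=> kK; elim: j => [|j IHj] jJ; first by rewrite /C big_ord_recr !big_ord0 /=; ring.
have CSj k' : C k' j.+1 = C k' j * j_ratio k' j by rewrite /C big_ord_recr /= mulrA.
by rewrite !CSj IHj 1?ltnW // -[LHS]mulrA -[RHS]mulrA ratio_comm.
Qed.

Let C_down_k k j : (k < K)%N -> (j <= J)%N ->
  C k.+1 j * k_down k.+1 j = C k j * k_up k j.
Proof. by move=> kK jJ; rewrite CS // -mulrA /k_ratio divfK // lt_eqF ?k_down_lt0. Qed.

Let C_ge0 k j : 0 <= C k j.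
Proof.
rewrite /C mulr_ge0 // prodr_ge0 // => i _.
  by rewrite /k_ratio -mulrNN -invrN mulr_ge0 ?invr_ge0 ?oppr_ge0 ?k_up_le0
    ?(ltW (k_down_lt0 _ _)).
by rewrite /j_ratio -mulrNN -invrN mulr_ge0 ?invr_ge0 ?oppr_ge0 ?j_up_le0
  ?(ltW (j_down_lt0 _ _)).
Qed.

(** * Expansion in eigenfunctions and orthogonality *)

Let r n := disk_poly Q a (n + e) n.

Let size_r n : size (r n) = n.+1. Proof. exact: size_disk_poly. Qed.

Let lambda n := eigenval Q a (n + e) n.

Let qdiff_r n x : qdiff (r n) x = lambda n * x * (r n).[x].
Proof.
rewrite -disk_poly_eigen //; congr (_ * (1 - _) * _ - _).
by rewrite exprS exprD; field; rewrite Qn.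
Qed.

(** The eigenvalues increase strictly: Q^-n - 1 is nonnegative and strictly increasing, 1 - a
    Q^(n+e+1) is positive and nondecreasing. *)
Let lambda_inj : injective lambda.
Proof.
suff lt_l i n : (i < n)%N -> lambda i < lambda n.
  by move=> i n; case: (ltngtP i n) => // /lt_l + E; rewrite E ltxx.
move=> ni; rewrite /lambda /eigenval.
have E k : (1 - Q ^+ k) / Q ^+ k = (Q ^+ k)^-1 - 1 by rewrite mulrBl mul1r divff.
rewrite !E; apply: (@le_lt_trans _ _ (((Q ^+ i)^-1 - 1) * (1 - a * Q ^+ (n + e).+1))).
  rewrite ler_wpM2l //.
    by rewrite subr_ge0 invf_ge1 ?exprn_gt0 // exprn_ile1 ?ltW.
  rewrite lerD2l lerN2 ler_pM2l // ler_wiXn2l ?ltW //.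
  by rewrite ltnS leq_add2r ltnW.
by rewrite ltr_pM2r ?oneBaQ_gt0 // ltrD2r ltf_pV2 ?posrE ?exprn_gt0 // ltr_iXn2l.
Qed.

(** The degrees add up to (m - j) + (k + j) + (m' - k), which does not depend on k and j. *)
Let size_ladder k j : (k <= K)%N -> (j <= J)%N ->
  (size (ladder_poly k j) <= (m + m').+1)%N.
Proof.
rewrite /K /J !leq_min => /andP[kl km'] /andP[jm jl'].
have s1 : (size (A k j \Po ((y k j)%:P * 'X))%R <= (m - j).+1)%N.
  apply: (leq_trans (size_comp_poly_leq _ _)).
  rewrite size_disk_poly -?cE //=.
  have : (size ((y k j)%:P * 'X)%R <= 2)%N.
    by rewrite mul_polyC (leq_trans (size_scale_leq _ _)) // size_polyX.
  by move=> ?; rewrite ltnS -[leqRHS]muln1 leq_mul // -subn1 leq_subLR.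
have s2 : (size (B k j) = (m' - k).+1)%N by rewrite size_disk_poly -?cE.
have s3 : (size ((A k j \Po ((y k j)%:P * 'X)) * 'X^(k + j))%R <= (m + k).+1)%N.
  apply: (leq_trans (size_polyMleq _ _)); rewrite size_polyXn addnS /=.
  by apply: (leq_trans (leq_add s1 (leqnn _))); clear -jm; lia.
apply: (leq_trans (size_polyMleq _ _)); rewrite s2 addnS /=.
by apply: (leq_trans (leq_add s3 (leqnn _))); clear -km'; lia.
Qed.

Let ladder_at0 k j : (ladder_poly k j).[0] = ((k == 0%N) && (j == 0%N))%:R.
Proof.
rewrite ladder_polyE mulr0 !disk_poly_at0 mulr1 mul1r expr0n addn_eq0.
by case: andP.
Qed.

Let qdiff_sum N (w : nat -> F) x : qdiff (\sum_(n < N) w n *: r n) x =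
  x * \sum_(n < N) lambda n * w n * (r n).[x].
Proof.
rewrite /qdiff !horner_sum -!sumrB !mulr_sumr -sumrB; apply: eq_bigr => n _.
rewrite !hornerZ; transitivity (w n * qdiff (r n) x); first by rewrite /qdiff; ring.
by rewrite qdiff_r; ring.
Qed.

Lemma linearization_coef_ge0 N (w : nat -> F) : (m + m' < N)%N ->
  ladder_poly 0 0 = \sum_(n < N) w n *: disk_poly Q a (n + e) n ->
  forall n, (n < N)%N -> 0 <= w n.
Proof.
move=> mN W00.
have /choice[v vE] (p : nat * nat) : exists v : nat -> F, (p.1 <= K)%N -> (p.2 <= J)%N ->
    ladder_poly p.1 p.2 = \sum_(n < N) v n *: r n.
  have [pK|?] := leqP p.1 K; last by exists w.
  have [pJ|?] := leqP p.2 J; last by exists w.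
  have [v ->] := triangular_expansion size_r (leq_trans (size_ladder pK pJ) mN).
  by exists v.
have {}vE k j : (k <= K)%N -> (j <= J)%N ->
  ladder_poly k j = \sum_(n < N) v (k, j) n *: r n by exact: (vE (k, j)).
have v00 n : (n < N)%N -> v (0%N, 0%N) n = w n.
  move=> nN; apply/eqP; rewrite -subr_eq0; apply/eqP.
  apply: (triangular_free size_r (w := fun n => v (0%N, 0%N) n - w n)) nN.
  under eq_bigr do rewrite scalerBl.
  by rewrite sumrB -vE // -W00 subrr.
pose V n k j := v (k, j) n.
(* The recurrence of [qdiff_ladder] passes to the coefficients of each r_n by linear independence,
   since both sides agree at all powers of Q. *)
have /choice[d dE] (p : nat * nat) : exists d : F, (p.1 <= K)%N -> (p.2 <= J)%N ->
  let: (k, j) := p in forall n, (n < N)%N ->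
  lambda n * V n k j = d * V n k j
    + (k_up k j * V n k.+1 j + k_down k j * V n k.-1 j)
    + (j_up k j * V n k j.+1 + j_down k j * V n k j.-1).
  case: p => k j /=.
  have [kK|?] := leqP k K; last by exists 0.
  have [jJ|?] := leqP j J; last by exists 0.
  have [||||d dE] := @qdiff_ladder k j;
    rewrite ?(leq_trans kK) ?(leq_trans jJ) ?geq_minl ?geq_minr //.
  exists d => _ _ n nN; apply/eqP; rewrite -subr_eq0; apply/eqP.
  pose g n := lambda n * V n k j - (d * V n k j
    + (k_up k j * V n k.+1 j + k_down k j * V n k.-1 j)
    + (j_up k j * V n k j.+1 + j_down k j * V n k j.-1)).
  apply: (triangular_free size_r (w := g)) nN.
  apply: (poly_eq0_on_powers (n0 := 0) Q_gt0 Q_lt1) => i _.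
  have xN0 := Qn i; move: (Q ^+ i) xN0 => x x0.
  (* At [k = K] no expansion of the next ladder polynomial is available, but its coefficient [k_up]
     is zero. *)
  have up1 : k_up k j * (ladder_poly k.+1 j).[x] =
      k_up k j * \sum_(n < N) V n k.+1 j * (r n).[x].
    case: (ltngtP k K) kK => // [kK _|-> _]; last by rewrite k_up_last !mul0r.
    by rewrite vE // horner_sum; under eq_bigr do rewrite hornerZ.
  have up2 : j_up k j * (ladder_poly k j.+1).[x] =
      j_up k j * \sum_(n < N) V n k j.+1 * (r n).[x].
    case: (ltngtP j J) jJ => // [jJ _|-> _]; last by rewrite j_up_last !mul0r.
    by rewrite vE // horner_sum; under eq_bigr do rewrite hornerZ.
  have := dE x x0; rewrite up1 up2 !vE ?(leq_trans (leq_pred _)) //.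
  rewrite qdiff_sum => /(mulfI x0).
  rewrite !horner_sum !mulr_sumr -!big_split /= => /eqP.
  rewrite -subr_eq0 -sumrB => /eqP E; rewrite -[RHS]E; apply: eq_bigr => n' _.
  by rewrite !hornerZ /g /V; ring.
have {}dE k j n : (k <= K)%N -> (j <= J)%N -> (n < N)%N ->
  lambda n * V n k j = d (k, j) * V n k j
    + (k_up k j * V n k.+1 j + k_down k j * V n k.-1 j)
    + (j_up k j * V n k j.+1 + j_down k j * V n k j.-1).
  by move=> kK jJ; exact: (dE (k, j)).
(* [S] is the Gram matrix of the coefficient vectors for the weights [C]. [T] has the ladder
   operator applied to the first vector, so that [T n n'] is [lambda n * S n n']. *)
pose S n n' := \sum_(k < K.+1) \sum_(j < J.+1) C k j * V n k j * V n' k j.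
have S_sym n n' : S n n' = S n' n.
  by apply: eq_bigr => k _; apply: eq_bigr => j _; rewrite mulrAC.
pose T n n' :=
  \sum_(k < K.+1) \sum_(j < J.+1) C k j * d (k : nat, j : nat) * V n k j * V n' k j
  + \sum_(j < J.+1) \sum_(k < K.+1)
      C k j * (k_up k j * V n k.+1 j + k_down k j * V n k.-1 j) * V n' k j
  + \sum_(k < K.+1) \sum_(j < J.+1)
      C k j * (j_up k j * V n k j.+1 + j_down k j * V n k j.-1) * V n' k j.
have T_sym n n' : T n n' = T n' n.
  congr (_ + _ + _).
  - by apply: eq_bigr => k _; apply: eq_bigr => j _; rewrite mulrAC.
  - apply: eq_bigr => -[j jJ] _ /=.
    apply: (@ladder_sum_sym _ K (C^~ j) (k_up^~ j) (k_down^~ j)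
      (V n ^~ j) (V n' ^~ j)); rewrite ?k_up_last ?k_down0 //.
    by move=> k kK; rewrite C_down_k.
  - apply: eq_bigr => -[k kK] _ /=.
    apply: (@ladder_sum_sym _ J (C k) (j_up k) (j_down k) (V n k) (V n' k));
      rewrite ?j_up_last ?j_down0 //.
have ST n n' : (n < N)%N -> lambda n * S n n' = T n n'.
  move=> nN; rewrite /T [X in _ + X + _]exchange_big /= -!big_split /=.
  rewrite mulr_sumr; apply: eq_bigr => -[k kK] _ /=.
  rewrite mulr_sumr -!big_split /=; apply: eq_bigr => -[j jJ] _ /=.
  transitivity (C k j * (lambda n * V n k j) * V n' k j); first by ring.
  by rewrite dE //; ring.
have S_diag n n' : (n < N)%N -> (n' < N)%N -> n != n' -> S n n' = 0.
  move=> nN n'N nn'; have := ST n n' nN; rewrite T_sym -ST // [S n' n]S_sym => /eqP.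
  rewrite -subr_eq0 -mulrBl mulf_eq0 subr_eq0 => /orP[/eqP /lambda_inj /eqP|/eqP //].
  by rewrite (negPf nn').
move=> n nN.
have -> : w n = S n n; last first.
  rewrite /S sumr_ge0 // => k _; rewrite sumr_ge0 // => j _.
  by rewrite -mulrA mulr_ge0 // -expr2 sqr_ge0.
(* This sum is evaluated twice: orthogonality leaves [S n n], and evaluation of the expansions at 0
   leaves [w n]. *)
transitivity (\sum_(n' < N) S n n'); last first.
  by rewrite (bigD1 (Ordinal nN)) //= big1 ?addr0 // => i ni; rewrite S_diag // eq_sym.
have sumV k j : (k <= K)%N -> (j <= J)%N ->
   \sum_(n' < N) V n' k j = ((k == 0%N) && (j == 0%N))%:R.
  move=> kK jJ; rewrite -ladder_at0 vE // horner_sum; apply: eq_bigr => i _.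
  by rewrite hornerZ disk_poly_at0 mulr1.
rewrite /S exchange_big /=.
transitivity (\sum_(k < K.+1) \sum_(j < J.+1)
    C k j * V n k j * ((k == 0%N :> nat) && (j == 0%N :> nat))%:R); last first.
  apply: eq_bigr => -[k kK] _ /=; rewrite exchange_big /=.
  by apply: eq_bigr => -[j jJ] _ /=; rewrite -mulr_sumr sumV.
rewrite !big_ord_recl /= big1 => [|i _]; last by rewrite mulr0.
rewrite big1 => [|i _]; last by rewrite big1 // => j _; rewrite mulr0.
by rewrite /C !big_ord0 !mul1r mulr1 !addr0 -v00.
Qed.
End Positivity.

(** * The sequence representation of the quantum disk *)

Section Representation.
Variables (R : realType) (q : R).
Implicit Types (f g : nat -> R[i]) (t : qd_term R).

(** A sequence [f] stands for the formal series with coefficient [f n] at t^n, so no finiteness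
    condition is carried along. *)
Definition seq_shift f n : R[i] := if n is n'.+1 then f n' else 0.

Definition seq_qderiv f n : R[i] := (1 - (q ^+ 2) ^+ n.+1)%:C * f n.+1.

(* [term_act t false] is the operator of [t] and [term_act t true] that of its
   star; carrying both gives a meaning to [QDstar] without an adjoint. *)
Fixpoint term_act t (adj : bool) f : nat -> R[i] :=
  match t with
  | QDgen => if adj then seq_qderiv f else seq_shift f
  | QDzero => fun=> 0
  | QDone => f
  | QDopp x => fun n => - term_act x adj f n
  | QDadd x y => fun n => term_act x adj f n + term_act y adj f n
  | QDmul x y => if adj then term_act y adj (term_act x adj f)
                 else term_act x adj (term_act y adj f)
  | QDscale c x => fun n => (if adj then conjc c else c) * term_act x adj f n
  | QDstar x => term_act x (~~ adj) f
  end.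

(** The distributivity and scalar axioms of [qd_cong] become linearity of the outer operator in a
    composition. *)
Lemma term_act_linear t adj c f g :
  term_act t adj (fun n => c * f n + g n) =
  fun n => c * term_act t adj f n + term_act t adj g n.
Proof.
elim: t adj c f g => /=.
- move=> [] c f g; apply/funext => n; rewrite /seq_qderiv /seq_shift; first by ring.
  by case: n => [|n]; rewrite ?mulr0 ?addr0.
- by move=> adj c f g; apply/funext => n; rewrite mulr0 addr0.
- by [].
- by move=> x IHx adj c f g; apply/funext => n; rewrite IHx; ring.
- by move=> x IHx y IHy adj c f g; apply/funext => n; rewrite IHx IHy; ring.
- by move=> x IHx y IHy [] c f g; rewrite ?IHx ?IHy ?IHx.
- by move=> d x IHx adj c f g; apply/funext => n; rewrite IHx; ring.
- by move=> x IHx adj c f g; rewrite IHx.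
Qed.

Lemma term_actD t adj f g : term_act t adj (fun n => f n + g n) =
  fun n => term_act t adj f n + term_act t adj g n.
Proof.
have -> : (fun n => f n + g n) = (fun n => 1 * f n + g n).
  by apply/funext => n; rewrite mul1r.
by rewrite term_act_linear; apply/funext => n; rewrite mul1r.
Qed.

Lemma term_act0 t adj : term_act t adj (fun=> 0) = fun=> 0.
Proof.
have := term_actD t adj (fun=> 0) (fun=> 0).
rewrite (_ : (fun n : nat => 0 + 0 : R[i]) = fun=> 0); last first.
  by apply/funext => n; rewrite addr0.
move=> E; apply/funext => n; have /eqP := congr1 (@^~ n) E.
by rewrite -subr_eq0 opprD addNKr oppr_eq0 => /eqP.
Qed.

Lemma term_actZ t adj c f : term_act t adj (fun n => c * f n) =
  fun n => c * term_act t adj f n.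
Proof.
have -> : (fun n => c * f n) = (fun n => c * f n + 0).
  by apply/funext => n; rewrite addr0.
rewrite (term_act_linear t adj c f (fun=> 0)) term_act0.
by apply/funext => n; rewrite addr0.
Qed.

Lemma seq_qderiv_shift f n : seq_qderiv (seq_shift f) n =
  (q ^+ 2)%:C * seq_shift (seq_qderiv f) n + (1 - q ^+ 2)%:C * f n.
Proof.
rewrite /seq_qderiv; case: n => [|n] /=; first by rewrite mulr0 add0r expr1.
rewrite mulrA -mulrDl -rmorphM -rmorphD; congr (_%:C * _).
by rewrite !exprS; ring.
Qed.

Lemma term_act_cong x y : qd_cong q x y -> term_act x = term_act y.
Proof.
elim=> {x y} /=; try by move=> *; apply/funext => adj; apply/funext => f;
  try apply/funext => n; repeat match goal with H : _ = _ |- _ => rewrite H end.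
(* This goal is [QDC_rel]. Both of its sides are self-adjoint, so [seq_qderiv_shift] settles both
   values of [adj]. *)
19: by apply/funext=> -[]; apply/funext=> f; apply/funext => n;
  rewrite /= ?oppr0; exact: seq_qderiv_shift.
all: move=> *; apply/funext => adj; apply/funext => f; apply/funext => n.
all: case: adj => //=; rewrite ?(term_actD, term_actZ, oppr0) ?rmorphD ?rmorphM
  ?conjcK ?negbK //; try ring.
all: by rewrite mul1r.
Qed.

Definition qact (x : qdisk q) : (nat -> R[i]) -> nat -> R[i] :=
  term_act (repr x) false.

Let qact_pi t : qact (\pi_(qdisk q) t) = term_act t false.
Proof. by rewrite /qact (term_act_cong (qd_repr q t)). Qed.

Lemma qact0 f : qact 0 f = fun=> 0.
Proof. by rewrite [0](_ : _ = \pi_(qdisk q) QDzero) ?qact_pi. Qed.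

Lemma qact1 f : qact 1 f = f.
Proof. by rewrite [1](_ : _ = \pi_(qdisk q) QDone) ?qact_pi. Qed.

Lemma qactD x y f n : qact (x + y) f n = qact x f n + qact y f n.
Proof.
elim/quotW: x => x; elim/quotW: y => y.
by rewrite qd_addE Defs.pi_add !qact_pi.
Qed.

Lemma qactN x f n : qact (- x) f n = - qact x f n.
Proof.
elim/quotW: x => x; rewrite [- _](_ : _ = \pi_(qdisk q) (QDopp x)) ?qact_pi //.
exact: Defs.pi_opp.
Qed.

Lemma qactM x y f : qact (x * y) f = qact x (qact y f).
Proof.
elim/quotW: x => x; elim/quotW: y => y.
by rewrite qd_mulE Defs.pi_mul !qact_pi.
Qed.

Lemma qactZ c x f n : qact (c *: x) f n = c * qact x f n.
Proof. by elim/quotW: x => x; rewrite qd_scaleE pi_scale !qact_pi. Qed.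

Lemma qact_z f : qact (qd_z q) f = seq_shift f.
Proof. by rewrite /qd_z qact_pi. Qed.

Lemma qact_zs f : qact (qd_star (qd_z q)) f = seq_qderiv f.
Proof. by rewrite /qd_z pi_star qact_pi. Qed.

Lemma qact_sum (I : Type) (r : seq I) (P : pred I) (F : I -> qdisk q) f n :
  qact (\sum_(i <- r | P i) F i) f n = \sum_(i <- r | P i) qact (F i) f n.
Proof.
apply: (big_morph (fun x => qact x f n)) => [x y|]; first exact: qactD.
by rewrite qact0.
Qed.

Lemma qact_scaler x c f n : qact x (fun i => c * f i) n = c * qact x f n.
Proof. by rewrite /qact term_actZ. Qed.

Notation z := (qd_z q).
Notation zs := (qd_star (qd_z q)).

(** Since 1 - z z^* is diagonal with eigenvalues Q^n, a polynomial in it acts through its values at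
    the powers of Q. *)
Lemma qact_oneBzzs f n : qact (1 - z * zs) f n = ((q ^+ 2) ^+ n)%:C * f n.
Proof.
rewrite qactD qactN qact1 qactM qact_z qact_zs.
case: n => [|n] /=; first by rewrite subr0 mul1r.
by rewrite /seq_qderiv -{1}[f n.+1]mul1r -mulrBl -rmorphB; congr (_%:C * _); ring.
Qed.

Lemma qact_zX d f n : qact (z ^+ d) f n = if (d <= n)%N then f (n - d)%N else 0.
Proof.
elim: d n => [|d IHd] n; first by rewrite qact1 subn0.
by rewrite exprS qactM qact_z; case: n => [|n] //=; rewrite IHd ltnS subSS.
Qed.

(** The factors collected on the way down from t^n form the product in [disk_poly_euler]. *)
Lemma qact_zsX b i n : 0 < q ->
  qact (zs ^+ b) (fun k => (k == n)%:R) i =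
  (\prod_(t < b) (1 - (q ^+ 2) ^+ n / (q ^+ 2) ^+ t))%:C * ((i + b)%N == n)%:R.
Proof.
move=> q0; elim: b i => [|b IHb] i; first by rewrite qact1 big_ord0 mul1r addn0.
rewrite exprS qactM qact_zs /seq_qderiv IHb addSnnS big_ord_recr /=.
case: eqVneq => [<-|]; last by rewrite !mulr0.
rewrite !mulr1 -rmorphM mulrC; congr ((_ * (1 - _))%:C).
by rewrite -addSnnS exprD mulfK // !expf_neq0 // gt_eqF.
Qed.

(** * The q-disk polynomials as weighted shifts *)

Variable alpha : R.
Hypotheses (q_gt0 : 0 < q) (q_lt1 : q < 1) (alpha_gt0 : 0 < alpha).

Let Q := q ^+ 2.
Let a := q `^ (2 * alpha).

Let Q_gt0 : 0 < Q. Proof. exact: exprn_gt0. Qed.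
Let Q_lt1 : Q < 1. Proof. by rewrite exprn_ilt1 ?ltW. Qed.

Lemma powR_q2_itv : 0 < q `^ (2 * alpha) < 1.
Proof.
rewrite powR_gt0 //= powRrM powR_mulrn ?ltW //.
have -> : 1 = 1 `^ alpha :> R by rewrite powR1.
by rewrite gt0_ltr_powR ?nnegrE ?ltW.
Qed.

Let a01 : 0 < a < 1 := powR_q2_itv.

Let powR_q2 n : q `^ (2 * n%:R) = Q ^+ n.
Proof. by rewrite -natrM powR_mulrn ?ltW // exprM. Qed.

Lemma little_qjacobi_coefE l m k :
  little_qjacobi_coef q m alpha l%:R k * Q ^+ k = disk_coef Q a (m + l) m k.
Proof.
rewrite /little_qjacobi_coef /qpochhammer /disk_coef powRN powR_q2.
have powD n : q `^ (2 * (alpha + n%:R)) = a * Q ^+ n.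
  rewrite mulrDr powRD ?powR_q2 //.
  by apply/implyP => _; rewrite gt_eqF.
have -> : alpha + l%:R + m%:R + 1 = alpha + (l + m).+1%:R.
  by rewrite -addn1 !natrD !addrA.
rewrite -[alpha + 1]/(alpha + 1%:R) !powD.
rewrite -!big_split /= -prodfV -big_split /= [Q ^+ k](_ : _ = \prod_(j < k) Q);
  last by rewrite prodr_const card_ord.
rewrite -big_split /=; apply: eq_bigr => i _.
rewrite -/Q mulrAC; congr (_ * _ / (_ * _)).
- congr (_ * _); first by rewrite mulrC.
  by rewrite -mulrA -exprD addSn [(l + m)%N]addnC.
- by rewrite expr1 -mulrA -exprS.
- by rewrite -exprS.
Qed.

Lemma little_qjacobi_act l m f n :
  qact (little_qjacobi q m alpha l%:R (1 - z * zs)) f n =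
  ((disk_poly Q a (m + l) m).[Q ^+ n])%:C * f n.
Proof.
rewrite /little_qjacobi qact_sum disk_polyE rmorph_sum mulr_suml.
apply: eq_bigr => -[k km] _ /=; rewrite qactZ.
have -> : qact ((Q%:C *: (1 - z * zs)) ^+ k) f n = ((Q * Q ^+ n) ^+ k)%:C * f n.
  elim: k {km} => [|k IHk]; first by rewrite qact1 expr0 mul1r.
  rewrite exprS qactM qactZ qact_oneBzzs IHk.
  by rewrite -/Q [in RHS]exprS !rmorphM /= !mulrA.
rewrite mulrA -rmorphM; congr (_%:C * _).
by rewrite exprMn mulrA little_qjacobi_coefE.
Qed.

(** For [m <= l] the polynomial acts before the shift, at Q^n. For [l < m] it acts after the
    lowering, at Q^i, and Euler's transformation moves it back to Q^n. The test [i + m == n + l]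
    avoids negative indices. *)
Lemma qdisk_poly_act l m n i :
  qact (qdisk_poly q alpha l m) (fun k => (k == n)%:R) i =
  ((disk_poly Q a l m).[Q ^+ n])%:C * ((i + m)%N == (n + l)%N)%:R.
Proof.
rewrite /qdisk_poly; case: leqP => ml; rewrite qactM.
  rewrite qact_zX; case: leqP => lmi; last first.
    rewrite (_ : (i + m == n + l)%N = false) ?mulr0 //.
    by apply/negP => /eqP; lia.
  rewrite little_qjacobi_act subnKC //; case: eqVneq => [<-|nE].
    by rewrite (_ : (i + m == i - (l - m) + l)%N) //; apply/eqP; lia.
  rewrite (_ : (i + m == n + l)%N = false) ?mulr0 //.
  by apply/negP => /eqP E; case/eqP: nE; lia.
rewrite little_qjacobi_act qact_zsX // (subnKC (ltnW ml)).
rewrite (_ : (i + (m - l) == n)%N = (i + m == n + l)%N); last by apply/eqP/eqP; lia.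
case: eqVneq => [E|]; last by rewrite !mulr0.
rewrite !mulr1 -rmorphM -[in RHS](subnKC (ltnW ml)) disk_poly_euler ?Qn_neq0 //.
rewrite mulrC subnKC 1?ltnW //; congr ((_ * _.[_])%:C).
rewrite -[in RHS](_ : i + (m - l) = n)%N; last by lia.
by rewrite exprD mulfK // Qn_neq0.
Qed.
End Representation.

(** * Linearization in the quantum disk *)

Section Involution.
Variables (R : realType) (q : R).
Implicit Types x : qdisk q.

Lemma conjc_RtoC (x : R) : conjc x%:C = x%:C.
Proof. by rewrite /= oppr0. Qed.

Lemma qd_star1 : qd_star (1 : qdisk q) = 1.
Proof.
rewrite -[RHS](qd_starK (1 : qdisk q)) -[X in _ = qd_star X]mulr1 qd_starM.
by rewrite qd_starK mulr1.
Qed.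

Lemma qd_star0 : qd_star (0 : qdisk q) = 0.
Proof. by rewrite -[X in qd_star X](scale0r 0) qd_starZ conjc0 scale0r. Qed.

Lemma qd_starN x : qd_star (- x) = - qd_star x.
Proof. by apply: (addIr (qd_star x)); rewrite -qd_starD !addNr qd_star0. Qed.

Lemma qd_starX x n : qd_star (x ^+ n) = qd_star x ^+ n.
Proof. by elim: n => [|n IHn]; rewrite ?qd_star1 // exprS exprSr qd_starM IHn. Qed.

Lemma qd_star_sum (I : Type) (r : seq I) (P : pred I) (F : I -> qdisk q) :
  qd_star (\sum_(i <- r | P i) F i) = \sum_(i <- r | P i) qd_star (F i).
Proof. exact: (big_morph _ (@qd_starD R q) qd_star0). Qed.

Lemma qd_star_little_qjacobi m alpha beta x : qd_star x = x ->
  qd_star (little_qjacobi q m alpha beta x) = little_qjacobi q m alpha beta x.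
Proof.
move=> xE; rewrite qd_star_sum; apply: eq_bigr => k _.
by rewrite qd_starZ qd_starX qd_starZ xE !conjc_RtoC.
Qed.

(** The polynomial has real coefficients in the self-adjoint 1 - z z^*, so the involution only
    carries the power of the generator to the other side. *)
Lemma qd_star_qdisk_poly alpha l m :
  qd_star (qdisk_poly q alpha l m) = qdisk_poly q alpha m l.
Proof.
have xE : qd_star (1 - qd_z q * qd_star (qd_z q)) = 1 - qd_z q * qd_star (qd_z q).
  by rewrite qd_starD qd_star1 qd_starN qd_starM qd_starK.
rewrite /qdisk_poly; case: (ltngtP m l) => [_|_|->];
  rewrite qd_starM qd_starX ?qd_starK qd_star_little_qjacobi //.
by rewrite !subnn !expr0 mul1r mulr1.
Qed.
End Involution.

Section FiniteSupportOnPairs.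

Lemma finite_pairs_bounded (S : set (nat * nat)) : finite_set S ->
  exists M, forall p, S p -> (p.1 < M)%N && (p.2 < M)%N.
Proof.
move=> /finite_seqP[s ->]; exists (\max_(p <- s) (maxn p.1 p.2).+1).
move=> p /= ps; rewrite -gtn_max.
exact: (leq_bigmax_seq (F := fun p => (maxn p.1 p.2).+1)).
Qed.

Lemma fsbig_pairs (V : zmodType) (G : nat * nat -> V) M M' :
  (forall p, G p != 0 -> (p.1 < M)%N && (p.2 < M')%N) ->
  \sum_(p \in [set: nat * nat]) G p = \sum_(i < M) \sum_(j < M') G (i : nat, j : nat).
Proof.
move=> GM; rewrite (fsbigE [seq (i, j) | i <- iota 0 M, j <- iota 0 M']) //.
- under eq_bigl do rewrite in_setT.
  rewrite big_allpairs.
  under eq_bigr do rewrite -[X in iota _ X]subn0 -/(index_iota _ _) big_mkord.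
  by rewrite -[X in iota _ X]subn0 -/(index_iota _ _) big_mkord.
- by rewrite allpairs_uniq ?iota_uniq // => -[? ?] [? ?].
- move=> [i j] _ ijN; apply/eqP; apply: contraNT ijN => /GM /= /andP[iM jM].
  by apply/allpairsP; exists (i, j); rewrite !mem_iota.
Qed.
End FiniteSupportOnPairs.

(** * Comparison of matrix entries in the representation *)

Section LinearizationCoefficients.
Variables (R : realType) (q alpha : R).
Hypotheses (q_gt0 : 0 < q) (q_lt1 : q < 1) (alpha_gt0 : 0 < alpha).

Let Q := q ^+ 2.
Let c := q `^ (2 * alpha).

(** The involution is applied to the expansion with the two index pairs exchanged; it sends R_{x,y}
    to R_{y,x}. *)
Lemma linearization_star a : is_linearization q alpha a ->
  is_linearization q alpha (fun l m l' m' x y => conjc (a l' m' l m y x)).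
Proof.
move=> lin l m l' m'; have [fin E] := lin l' m' l m.
have [M MP] := finite_pairs_bounded fin; split.
  apply: (@sub_finite_set _ _
    ((fun p => (p.2, p.1)) @` [set p | a l' m' l m p.1 p.2 != 0])).
    by move=> -[x y] /=; rewrite conjc_eq0 => axy; exists (y, x).
  exact: finite_image.
rewrite -[qdisk_poly q alpha l m]qd_starK -qd_starM E.
rewrite !(@fsbig_pairs _ _ M M) => [|[x y] /=|p].
- rewrite qd_star_sum exchange_big /=; apply: eq_bigr => i _; rewrite qd_star_sum.
  by apply: eq_bigr => j _; rewrite qd_starZ qd_star_qdisk_poly.
- move=> h; rewrite andbC; apply: (MP (y, x)).
  by apply: contraNneq h => /= ->; rewrite conjc0 scale0r.
- by move=> h; apply: MP; apply: contraNneq h => /= ->; rewrite scale0r.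
Qed.

(* Only for y <= x do the polynomials r_{t + x - y,t}, t >= 0, have one element in
   each degree; the involution exchanges the two cases. *)
Lemma linearization_ge0_above a l m l' m' x y : is_linearization q alpha a ->
  (y <= x)%N -> 0 <= a l m l' m' x y.
Proof.
move=> lin yx; have [fin E] := lin l m l' m'.
have [M MP] := finite_pairs_bounded fin.
pose e := (x - y)%N.
pose b t := a l m l' m' (t + e)%N t.
(* [N] exceeds the support, the degree bound [m + l'] of the product, and [y]. *)
pose N := (M + (m + l').+1 + y.+1)%N.
pose r t := disk_poly Q c (t + e) t.
(* This tests whether the product has z-degree [e]; if not, its components in that degree vanish.
   The second pair in [W] is m', l' because the adjoint of R_{l',m'} is R_{m',l'}. *)
pose matched := (l + m' == e + m + l')%N.
pose W := ladder_poly Q c l m m' l' 0 0.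
have Q0 : 0 < Q by exact: exprn_gt0.
have Q1 : Q < 1 by rewrite exprn_ilt1 ?ltW.
have c01 : 0 < c < 1 by exact: powR_q2_itv.
have size_r t : size (r t) = t.+1 by exact: size_disk_poly.
(* The entry from t^n to t^(n+e) sees only the pairs with first index minus second equal to [e]. The
   bound on [n] makes [n + m' - l'] a genuine subtraction. *)
have act_eq n : (l' <= n)%N ->
  (matched%:R * W.[Q ^+ n])%:C = \sum_(t < N) b t * ((r t).[Q ^+ n])%:C.
  move=> l'n; have := congr1 (fun u => qact u (fun k => (k == n)%:R) (n + e)%N) E.
  rewrite (@fsbig_pairs _ _ (N + e) N) => [|p h]; last first.
    have : (p.1 < M)%N && (p.2 < M)%N.
      by apply: MP; apply: contraNneq h => /= ->; rewrite scale0r.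
    by rewrite /N; lia.
  rewrite exchange_big /= qact_sum qactM qd_star_qdisk_poly => Eact.
  transitivity (\sum_(t < N) \sum_(s < N + e) a l m l' m' s t *
    (((disk_poly Q c s t).[Q ^+ n])%:C * ((n + e + t)%N == (n + s)%N)%:R)).
    transitivity (qact (qdisk_poly q alpha l m)
      (fun k => ((disk_poly Q c m' l').[Q ^+ n])%:C * (k == n + m' - l')%N%:R) (n + e)%N).
      rewrite qact_scaler qdisk_poly_act // -/Q -/c.
      rewrite (_ : (n + e + m == n + m' - l' + l)%N = matched); last first.
        by apply/eqP/eqP; lia.
      rewrite /W ladder_polyE !subn0 addn0 !expr0 !mulr1.
      have -> : Q ^+ m' / Q ^+ l' * Q ^+ n = Q ^+ (n + m' - l').
        rewrite mulrAC -exprD addnC.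
        rewrite -[in LHS](subnK (_ : l' <= n + m')%N) ?exprD ?mulfK //.
          by rewrite Qn_neq0.
        by lia.
      by rewrite !rmorphM /= rmorph_nat; ring.
    rewrite (_ : (fun k => _) = qact (qdisk_poly q alpha m' l') (fun k => (k == n)%:R)).
      rewrite Eact; apply: eq_bigr => t _; rewrite qact_sum.
      by apply: eq_bigr => s _; rewrite qactZ qdisk_poly_act.
    apply/funext => k; rewrite qdisk_poly_act //; congr (_ * (nat_of_bool _)%:R).
    by apply/eqP/eqP; lia.
  apply: eq_bigr => -[t tN] _ /=.
  have teN : (t + e < N + e)%N by rewrite ltn_add2r.
  rewrite (bigD1 (Ordinal teN)) //= big1 => [|s /eqP sE].
    by rewrite addr0 /b /r addnAC -addnA eqxx mulr1 addnC.
  rewrite (_ : (n + e + t == n + s)%N = false) ?mulr0 //.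
  by apply/negP => /eqP E'; apply: sE; apply: val_inj => /=; lia.
(* [W] and the [r t] are real, so the identity splits: the imaginary parts vanish by independence,
   and the real parts expand [W], or 0 when unmatched. *)
pose Re_b t := complex.Re (b t); pose Im_b t := complex.Im (b t).
have Re_mul (u : R[i]) (v : R) : complex.Re (u * v%:C) = complex.Re u * v.
  by case: u => ? ?; rewrite /= mulr0 subr0.
have Im_mul (u : R[i]) (v : R) : complex.Im (u * v%:C) = complex.Im u * v.
  by case: u => ? ?; rewrite /= mulr0 add0r.
have ReE : matched%:R *: W = \sum_(t < N) Re_b t *: r t.
  apply/eqP; rewrite -subr_eq0; apply/eqP.
  apply: (poly_eq0_on_powers (n0 := l') Q0 Q1) => n /act_eq /(congr1 (@complex.Re R)).
  rewrite raddf_sum /= hornerD hornerN horner_sum hornerZ => ->; apply/eqP.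
  rewrite subr_eq0; apply/eqP/eq_bigr => t _.
  by rewrite hornerZ Re_mul.
have ImE : \sum_(t < N) Im_b t *: r t = 0.
  apply: (poly_eq0_on_powers (n0 := l') Q0 Q1) => n /act_eq /(congr1 (@complex.Im R)).
  rewrite raddf_sum /= horner_sum => E0; rewrite [RHS]E0.
  by apply: eq_bigr => t _; rewrite hornerZ Im_mul.
have yN : (y < N)%N by rewrite /N; lia.
have axy : a l m l' m' x y = b y by rewrite /b /e subnKC.
rewrite axy lecE /= -/(Im_b y) (triangular_free size_r ImE yN) eqxx /=.
move: ReE; case: (eqVneq (l + m')%N (e + m + l')%N) @matched {act_eq} => weight matched.
  rewrite scale1r => ReE.
  by apply: (linearization_coef_ge0 Q0 Q1 c01 weight _ ReE) => //; rewrite /N; lia.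
rewrite scale0r => /esym ReE.
by rewrite -/(Re_b y) (triangular_free size_r ReE yN).
Qed.
End LinearizationCoefficients.

Theorem theorem4 (R : realType) (q alpha : R)
    (a : nat -> nat -> nat -> nat -> nat -> nat -> R[i]) :
  0 < q -> q < 1 -> 0 < alpha ->
  is_linearization q alpha a ->
  forall l m l' m' l'' m'' : nat, 0 <= a l m l' m' l'' m''.
Proof.
move=> q_gt0 q_lt1 alpha_gt0 lin l m l' m' x y.
have [yx|xy] := leqP y x; first exact: (linearization_ge0_above q_gt0 q_lt1 alpha_gt0).
have := linearization_ge0_above q_gt0 q_lt1 alpha_gt0 l' m' l m
  (linearization_star lin) (ltnW xy).
by rewrite conjC_ge0.
Qed.
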